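(* Let $V=\mathbb{N}$ or $V=\mathbb{Z}$, and let $X$ be a Fréchet sequence space over $V$ in which the sequence of canonical vectors $(e_n)_{n\in V}$ is a Schauder basis. Assume that $(\|\cdot\|_k)_{k\in\mathbb{N}}$ is an increasing sequence of seminorms inducing the topology of $X$, and that $\lambda=(\lambda_n)_{n\in V}\in\mathbb{K}^V$ is a sequence of non-zero weights such that the (unilateral if $V=\mathbb{N}$, bilateral if $V=\mathbb{Z}$) weighted backward shift $$B_\lambda:(f(n))_{n\in V}\in X\longmapsto(\lambda_{n+1}\cdot f(n+1))_{n\in V}\in X$$ is a well-defined operator. Then the following statements are equivalent: (i) $B_\lambda$ is a chain recurrent operator (that is, $CR(B_\lambda)=X$); (ii) $B_\lambda$ admits a non-zero chain recurrent vector (that is, $CR(B_\lambda)\neq\{0_X\}$); (iii) for some (and hence for every) integer $n_0\in V\cup\{0\}$ it holds that, for all $k\in\mathbb{N}$, $$\sum_{n=1}^\infty\frac{|\lambda_{n_0+1}\cdots\lambda_{n_0+n}|}{\|e_{n_0+n}\|_k}=\infty\quad\text{when } V=\mathbb{N}\text{ or }\mathbb{Z},$$ and $$\sum_{n=1}^\infty\frac{1}{|\lambda_{n_0-(n-1)}\cdots\lambda_{n_0}|\cdot\|e_{n_0-n}\|_k}=\infty\quad\text{when } V=\mathbb{Z}.$$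
   Context: $\mathbb{K}$ denotes $\mathbb{R}$ or $\mathbb{C}$ and $\mathbb{N}=\{1,2,\dots\}$. Convention: $c/0=\infty$ whenever $c\in\,]0,\infty[$. A Fréchet space is a locally convex, completely metrizable topological vector space. $\mathbb{K}^V$ is the space of all sequences $f=(f(n))_{n\in V}$ with the product topology; $e_n$ is the canonical unit sequence (equal to $1$ at $n$ and $0$ elsewhere). A Fréchet sequence space over $V$ is a linear subspace $X\subset\mathbb{K}^V$ endowed with a Fréchet space topology for which the canonical embedding $X\hookrightarrow\mathbb{K}^V$ is continuous. The shift $B_\lambda$ is well-defined on $X$ if it maps $X$ into itself (it is then continuous by the Closed Graph Theorem). Chain recurrence. Let $X$ be a Fréchet space with topology induced by an increasing sequence of seminorms $(\|\cdot\|_k)_{k\in\mathbb{N}}$, and put $\|f\|:=\sum_{k\in\mathbb{N}}2^{-k}\min\{1,\|f\|_k\}$, so that $d(f,g)=\|f-g\|$ is a translation-invariant metric inducing the topology (if $X$ is Banach, $\|\cdot\|$ denotes its norm). Let $T:X\to X$ be a continuous linear operator. Given $\delta>0$, a finite sequence $(f_l)_{l=0}^m$ in $X$, with $m\in\mathbb{N}$, is a $\delta$-chain for $T$ from $f_0$ to $f_m$ if $\|f_l-T(f_{l-1})\|<\delta$ for every $1\leq l\leq m$. A vector $f\in X$ is chain recurrent for $T$ if for every $\delta>0$ there exists a $\delta$-chain for $T$ from $f$ to itself. $CR(T)$ is the set of chain recurrent vectors for $T$, and $T$ is chain recurrent if $CR(T)=X$. $0_X$ is the zero-vector of $X$. 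*)

(* Defs.v *)
From HB Require Import structures.
From mathcomp Require Import all_boot all_order all_algebra.
From mathcomp Require Import all_classical all_reals all_analysis.
From mathcomp Require Import complex.
Import Order.TTheory GRing.Theory Num.Theory.
Import numFieldNormedType.Exports.

Set Implicit Arguments.
Unset Strict Implicit.
Unset Printing Implicit Defensive.

Local Open Scope classical_set_scope.
Local Open Scope ring_scope.

(* The scalar field K: R or C, with its real-valued modulus (the norm of the
   library on R[i] takes its values in R[i]). *)
Variant scalar_kind := RealScalars | ComplexScalars.

Definition scalar_field (R : realType) (s : scalar_kind) : numFieldType :=
  match s with
  | RealScalars => R
  | ComplexScalars => R[i]
  end.

Definition modulus (R : realType) (s : scalar_kind) : scalar_field R s -> R :=
  match s with
  | RealScalars => fun x : R => `|x|
  | ComplexScalars => fun z : R[i] => ComplexField.Normc.normc z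
  end.

(* The index set V, as a set of integers: {1, 2, ...} or all of Z. *)
Variant index_kind := Unilateral | Bilateral.

Definition in_index (V : index_kind) (n : int) : bool :=
  match V with
  | Unilateral => 1 <= n
  | Bilateral => true
  end.

Definition index_set (V : index_kind) : Type := {n : int | in_index V n}.

(* The value of a V-indexed family at an integer; 0 is a dummy value outside V. *)
Definition at_int (V : index_kind) (T : nmodType) (u : index_set V -> T) (n : int)
    : T :=
  if insub n is Some v then u v else 0.

Definition completely_metrizable (R : realType) (X : topologicalType) : Prop :=
  exists d : X -> X -> R,
    [/\ (forall x y, 0 <= d x y) /\ (forall x y, d x y = 0 <-> x = y),
        forall x y, d x y = d y x,
        forall x y z, d x z <= d x y + d y z,
        (forall x (A : set X),
           nbhs x A <-> exists2 e : R, 0 < e & [set y | d x y < e] `<=` A)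
      & forall u : nat -> X,
          (forall e : R, 0 < e ->
             exists N : nat, forall m n, (N <= m)%N -> (N <= n)%N ->
               d (u m) (u n) < e) ->
          exists x : X, u @ \oo --> x].

Section FrechetSequenceSpaces.
Context {R : realType} {s : scalar_kind} {V : index_kind}.
Local Notation K := (scalar_field R s).

(* In the library a [tvsType] is locally convex by definition. *)
Definition frechet (X : tvsType K) : Prop := completely_metrizable R X.

(* A linear subspace of K^V is rendered as a space X together with its
   canonical embedding in K^V. *)
Definition frechet_sequence_space (X : tvsType K)
    (emb : {linear X -> (index_set V -> K^o)}) : Prop :=
  [/\ frechet X,
      injective emb
    & continuous (emb : X -> {ptws index_set V -> K^o})].

Definition unit_sequence (n : index_set V) : index_set V -> K :=
  fun m => (m == n)%:R.

(* The partial sums run over the n in V with |n| <= N; for V = {1, 2, ...} this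
   is 1 <= n <= N. *)
Definition schauder_basis (X : tvsType K) (e : index_set V -> X) : Prop :=
  forall f : X, exists! a : index_set V -> K,
    (fun N : nat => \sum_(i < N.*2.+1)
       at_int a (i%:Z - N%:Z) *: at_int e (i%:Z - N%:Z)) @ \oo --> f.

Definition seminorm (X : lmodType K) (p : X -> R) : Prop :=
  (forall f g, p (f + g) <= p f + p g) /\
  (forall (a : K) f, p (a *: f) = modulus a * p f).

(* The seminorm ||.||_k, k >= 1, is p k.-1.  Since the sequence increases, the
   balls of the single seminorms form a basis of neighbourhoods. *)
Definition increasing_seminorms_inducing (X : tvsType K) (p : nat -> X -> R)
    : Prop :=
  [/\ forall k, seminorm (p k),
      forall k f, p k f <= p k.+1 f
    & forall f (A : set X), nbhs f A <->
        exists k, exists2 r : R, 0 < r & [set g | p k (g - f) < r] `<=` A].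

Definition fnorm (X : tvsType K) (p : nat -> X -> R) (f : X) : R :=
  limn (series (fun k => 2^-1 ^+ k.+1 * Num.min 1 (p k f))).

Section ChainRecurrence.
Context {X : tvsType K} (p : nat -> X -> R) (T : X -> X).

(* The chain is given by the values c 0, ..., c m; later values are ignored. *)
Definition delta_chain (delta : R) (m : nat) (c : nat -> X) (f g : X) : Prop :=
  [/\ (1 <= m)%N, c 0 = f, c m = g
    & forall l, (1 <= l <= m)%N -> fnorm p (c l - T (c l.-1)) < delta].

Definition chain_recurrent_vector (f : X) : Prop :=
  forall delta : R, 0 < delta -> exists m c, delta_chain delta m c f f.

Definition CR : set X := [set f | chain_recurrent_vector f].

Definition chain_recurrent_operator : Prop := CR = setT.

End ChainRecurrence.

(* For n in V, n + 1 is in V as well, so no dummy value occurs. *)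
Definition weighted_shift (lambda f : index_set V -> K) : index_set V -> K :=
  fun n => at_int lambda (val n + 1) * at_int f (val n + 1).

Section Series.
Context {X : tvsType K} (p : nat -> X -> R) (e : index_set V -> X).
Context (lambda : index_set V -> K).
Local Open Scope ereal_scope.

(* In \bar R the library's inverse of 0 is +oo, hence c / 0 = +oo for c > 0. *)
Definition forward_series (n0 : int) (k : nat) : \bar R :=
  \sum_(1 <= n <oo)
    ((modulus (\prod_(1 <= i < n.+1) at_int lambda (n0 + i%:Z))%R)%:E
       / (p k (at_int e (n0 + n%:Z)%R))%:E).

Definition backward_series (n0 : int) (k : nat) : \bar R :=
  \sum_(1 <= n <oo)
    (1 / (modulus (\prod_(0 <= i < n) at_int lambda (n0 - i%:Z))%R
            * p k (at_int e (n0 - n%:Z)))%R%:E).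

Definition divergence_condition (n0 : int) : Prop :=
  forall k, forward_series n0 k = +oo /\
            (V = Bilateral -> backward_series n0 k = +oo).

End Series.

End FrechetSequenceSpaces.

(* Main.v *)
Require Import Defs.
From HB Require Import structures.
From mathcomp Require Import all_boot all_order all_algebra.
From mathcomp Require Import all_classical all_reals all_analysis.
From mathcomp Require Import complex lra zify.
Import Order.TTheory GRing.Theory Num.Theory.
Import numFieldNormedType.Exports.
Local Open Scope classical_set_scope.
Local Open Scope ring_scope.

(** Rescaling the unit vectors removes the weights.  If [W] solves
    [W (n + 1) = W n * lambda (n + 1)], then [h n = e n / W n] and
    [phi n f = W n * f n] satisfy [B (h n) = h (n - 1)] and
    [phi n (B f) = phi (n + 1) f], and up to the constant factor
    [1 / |W n0|] the two series are [sum_j 1 / p k (h (n0 + j))] and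
    [sum_j 1 / p k (h (n0 - j))].

    Such a series [sum_j 1 / q j] diverges exactly when for every [eps] there
    are finitely many convex weights [w j] with [w j * q j < eps]
    ([reciprocal_series_pinfty]).  Convex weights are what a pseudo-orbit
    needs.  A chain of length [m] from [f] to [g] amounts to
    [g = B^m f + sum_(j < m) B^j (u j)] with small errors [u j]
    ([pseudo_orbitE], [chain_recurrentP]).  If the forward series diverges,
    then [h n = sum_j w j * h n = sum_j B^j (w j * h (n + j))] is such a sum of
    small errors, so [h n] is reached from [0]; if the backward series diverges,
    [B^m (h n) = h (n - m) = sum_j B^(m - j) (w j * h (n - j))] can be cancelled,
    so [0] is reached from [h n] (on the positive integers, [B^n (h n) = 0]).
    The vectors linked to [0] in both directions form a linear subspace, closed
    because [B] is continuous, and the [h n] span a dense subspace; hence every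
    vector is chain recurrent ([divergence_chain_recurrent]).

    Conversely, let [f] be chain recurrent with [phi n f <> 0], and suppose that
    the forward series at [n - 1] converges for some [k].  Applying [phi n] to
    [f = B^m f + sum_j B^j (u j)] gives
    [phi n f = phi (n + m) f + sum_j phi (n + j) (u j)].  If [|phi i x|] is at
    most a constant times [p k' x / p k (h (i - 1))], uniformly in [i], then the
    right-hand side is small: the errors by the convergence of the series, the
    first term because [m] may be taken large.  So [phi n f = 0], a
    contradiction.  The backward series is treated in the same way, starting
    from [phi (n - m)] ([chain_recurrent_divergence]).

    The uniform bound comes from the uniform boundedness principle
    ([uniform_domination], by Baire).  Since the partial sums are symmetric, this
    principle only bounds the pairs [phi N f * h N + phi (- N) f * h (- N)],
    in which the two terms could compensate each other.  The shift separates
    them: it moves both indices in the same direction, so that only one of the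
    images has the absolute value [|n - 1|] of the image of [h n]
    ([block_shift_block]).  This is why the bound involves [h (i - 1)] instead of
    [h i] ([shifted_coordinate_bound]).  The same principle gives the continuity
    of [B] ([shift_continuous]).

    Finally, replacing [n0] by [n0 + 1] adds or removes one term of each series.
    Adding a term is harmless; removing one is harmless as soon as the term is
    finite, which is achieved by enlarging [k] ([model_divergence_indep]). *)

Set Implicit Arguments.
Unset Strict Implicit.
Unset Printing Implicit Defensive.

(** * Scalars *)

Section Modulus.
Context {R : realType} {s : scalar_kind}.
Local Notation K := (scalar_field R s).
Implicit Types a b : K.

Lemma modulusM a b : modulus (a * b) = modulus a * modulus b.
Proof. by case: s a b => a b; [exact: normrM | exact: ComplexField.Normc.normcM]. Qed.

Lemma modulusD a b : modulus (a + b) <= modulus a + modulus b.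
Proof. by case: s a b => a b; [exact: ler_normD | exact: le_normcD]. Qed.

Lemma modulus1 : modulus (1 : K) = 1.
Proof. by case: s; [exact: normr1 | exact: ComplexField.Normc.normc1]. Qed.

Lemma modulus0 : modulus (0 : K) = 0.
Proof. by case: s; [exact: normr0 | exact: ComplexField.Normc.normc0]. Qed.

Lemma modulus_eq0 a : modulus a = 0 -> a = 0.
Proof.
case: s a => a; first by move/eqP; rewrite normr_eq0 => /eqP.
exact: ComplexField.Normc.eq0_normc.
Qed.

Lemma modulusN a : modulus (- a) = modulus a.
Proof. by case: s a => a; [exact: normrN | exact: normcN]. Qed.

Lemma modulus_ge0 a : 0 <= modulus a.
Proof. by have := modulusD a (- a); rewrite subrr modulusN modulus0; lra. Qed.

Lemma modulus_gt0 a : a != 0 -> 0 < modulus a.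
Proof.
by move=> a0; rewrite lt_def modulus_ge0 andbT; apply: contra_neq a0 => /modulus_eq0.
Qed.

Lemma modulusV a : modulus a^-1 = (modulus a)^-1.
Proof.
have [->|a0] := eqVneq a 0; first by rewrite !(invr0, modulus0).
apply: (mulfI (lt0r_neq0 (modulus_gt0 a0))).
by rewrite -modulusM (divff a0) modulus1 divff// lt0r_neq0// modulus_gt0.
Qed.

Lemma modulus_sum (I : Type) (r : seq I) (F : I -> K) :
  modulus (\sum_(i <- r) F i) <= \sum_(i <- r) modulus (F i).
Proof.
apply: (big_ind2 (fun a t => modulus a <= t)) => [|x u y v xu yv|//].
  by rewrite modulus0.
by apply: le_trans (modulusD _ _) _; exact: lerD.
Qed.

Definition real_scalar : R -> K :=
  match s return R -> scalar_field R s with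
  | RealScalars => fun t => t
  | ComplexScalars => fun t => t%:C%C
  end.

Lemma modulus_real_scalar (t : R) : 0 <= t -> modulus (real_scalar t) = t.
Proof.
rewrite /real_scalar; case: s => /=; first exact: ger0_norm.
by move=> t0; rewrite expr0n addr0 sqrtr_sqr ger0_norm.
Qed.

Lemma real_scalar1 : real_scalar 1 = 1.
Proof. by rewrite /real_scalar; case: s. Qed.

Lemma real_scalar_sum (I : Type) (r : seq I) (F : I -> R) :
  real_scalar (\sum_(i <- r) F i) = \sum_(i <- r) real_scalar (F i).
Proof.
rewrite /real_scalar; case: s => //=.
exact: (@raddf_sum _ _ (@real_complex R)).
Qed.

(** The order and the norm of the complex numbers take their values in the
    complex numbers themselves; this is what connects them with [modulus]. *)
Lemma norm_modulus a : `|a| = real_scalar (modulus a).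
Proof. by rewrite /real_scalar; case: s a. Qed.

Lemma ltr_real_scalar (t u : R) : (real_scalar t < real_scalar u) = (t < u).
Proof. by rewrite /real_scalar; case: s => //=; exact: ltcR. Qed.

End Modulus.

(** * Divergence of a series of reciprocals *)

Section ConvexlySmall.
Context {R : realType}.
Implicit Types q : nat -> R.

(** This says that the sum of the [1 / q j] is infinite, with [1 / 0 = +oo], in
    the form in which pseudo-orbits use it: a fixed vector can be split into
    finitely many parts [w j] whose costs [w j * q j] are all small. *)
Definition convexly_small q : Prop := forall eps : R, 0 < eps ->
  exists m (w : nat -> R),
    [/\ forall j, 0 <= w j, \sum_(j < m) w j = 1
      & forall j, (j < m)%N -> w j * q j < eps].

(** If the partial sums of the reciprocals are unbounded, weights proportional
    to [1 / q j] make all costs [w j * q j] equal to the inverse of a large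
    partial sum; if some [q j] vanishes, all the weight is put there. *)
Lemma convexly_small_or_summable q : (forall j, 0 <= q j) ->
  convexly_small q \/
  (forall j, 0 < q j) /\ exists S : R, forall m, \sum_(j < m) (q j)^-1 <= S.
Proof.
move=> q0.
have [[j qj0]|qn0] := pselect (exists j, q j = 0).
  left=> eps eps0; exists j.+1, (fun i => (i == j)%:R); split => //.
  - rewrite (bigD1 ord_max)//= eqxx big1 ?addr0// => i.
    by rewrite -val_eqE /= => /negPf ->.
  - move=> i _; case: eqVneq => [->|_]; first by rewrite qj0 mulr0.
    by rewrite mul0r.
have qp j : 0 < q j.
  by rewrite lt_def q0 andbT; apply/eqP => qj0; apply: qn0; exists j.
have [qS|qsmall] := pselect (exists S : R, forall m, \sum_(j < m) (q j)^-1 <= S).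
  by right.
left=> eps eps0.
have [m mS] : exists m, eps^-1 < \sum_(j < m) (q j)^-1.
  apply: contrapT => nS; apply: qsmall; exists eps^-1 => m.
  by rewrite leNgt; apply/negP => ?; apply: nS; exists m.
set S := \sum_(j < m) (q j)^-1 in mS.
have S0 : 0 < S by rewrite (lt_trans _ mS)// invr_gt0.
exists m, (fun j => (q j)^-1 / S); split.
- by move=> j; rewrite divr_ge0 ?invr_ge0// ltW.
- by rewrite -mulr_suml divff ?gt_eqF.
- move=> j _; rewrite mulrAC mulVf ?gt_eqF// mul1r.
  by rewrite -[ltRHS]invrK ltf_pV2// posrE invr_gt0.
Qed.

(** If the series had a finite sum [S], then convex weights of cost below [eps]
    would give [1 = sum_j w j <= eps * sum_j 1 / q j <= eps * S]. *)
Lemma reciprocal_series_pinfty q : (forall j, 0 <= q j) ->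
  (\sum_(1 <= n <oo) ((q n.-1)%:E)^-1)%E = +oo%E <-> convexly_small q.
Proof.
move=> q0.
have F0 n : (0 <= ((q n.-1)%:E)^-1 :> \bar R)%E by rewrite inve_ge0 lee_fin.
have ps m : (\sum_(1 <= n < m.+1) ((q n.-1)%:E)^-1 =
             \sum_(j < m) ((q j)%:E)^-1)%E by rewrite big_add1/= big_mkord.
have fin (qp : forall j, 0 < q j) m :
    (\sum_(j < m) ((q j)%:E)^-1 = (\sum_(j < m) (q j)^-1)%:E :> \bar R)%E.
  by rewrite -sumEFin; apply: eq_bigr => j _; rewrite inver gt_eqF.
split.
  move=> soo; have [//|[qp [S qS]]] := convexly_small_or_summable q0.
  suff : (\sum_(1 <= n <oo) ((q n.-1)%:E)^-1 <= S%:E)%E.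
    by rewrite soo leye_eq.
  apply: lime_le; first by apply: is_cvg_nneseries => n _ _.
  apply: nearW => -[|m]; last by rewrite ps fin// lee_fin.
  by rewrite big_geq// lee_fin (le_trans _ (qS 0%N))// big_ord0.
move=> qs; apply: contrapT => /eqP; rewrite -ltey => sfin.
have le m : (\sum_(j < m) ((q j)%:E)^-1 <=
    \sum_(1 <= n <oo) ((q n.-1)%:E)^-1)%E.
  by rewrite -ps; apply: nneseries_lim_ge => n _ _; exact: F0.
have qp j : 0 < q j.
  rewrite lt_def q0 andbT; apply/eqP => qj0; have := le j.+1.
  rewrite big_ord_recr/= qj0 inve0 addey.
    by rewrite leye_eq => /eqP ss; rewrite ss in sfin.
  rewrite gt_eqF// (lt_le_trans (ltNyr 0))// sume_ge0// => i _.
  by rewrite inve_ge0 lee_fin.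
have [S ES] : exists S : R, (\sum_(1 <= n <oo) ((q n.-1)%:E)^-1)%E = S%:E.
  exists (fine (\sum_(1 <= n <oo) ((q n.-1)%:E)^-1)%E); rewrite fineK//.
  by rewrite ge0_fin_numE// nneseries_ge0// => n _ _.
have qS m : \sum_(j < m) (q j)^-1 <= S by rewrite -lee_fin -ES -fin.
have S0 : 0 <= S by rewrite (le_trans _ (qS 0%N))// big_ord0.
have e0 : 0 < (S + 1)^-1 by rewrite invr_gt0; lra.
have [m [w [w0 w1 wq]]] := qs _ e0.
have : 1 <= (S + 1)^-1 * S.
  rewrite -[leLHS]w1; apply: le_trans (ler_wpM2l (ltW e0) (qS m)).
  rewrite mulr_sumr; apply: ler_sum.
  by move=> j _; rewrite ler_pdivlMr// ltW// wq.
by rewrite mulrC ler_pdivlMr; lra.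
Qed.

Lemma convexly_smallZ q c : 0 < c ->
  convexly_small q -> convexly_small (fun j => c * q j).
Proof.
move=> c0 qs eps eps0; have [|m [w [w0 w1 wq]]] := qs (eps / c).
  by rewrite divr_gt0.
exists m, w; split => // j jm; rewrite mulrCA mulrC -ltr_pdivlMr//; exact: wq.
Qed.

Lemma convexly_small_le q q' : (forall j, q' j <= q j) ->
  convexly_small q -> convexly_small q'.
Proof.
move=> qq qs eps eps0; have [m [w [w0 w1 wq]]] := qs _ eps0.
exists m, w; split => // j jm; apply: le_lt_trans (wq _ jm).
exact: ler_wpM2l.
Qed.

Lemma convexly_small_cons q :
  convexly_small (fun j => q j.+1) -> convexly_small q.
Proof.
move=> qs eps eps0; have [m [w [w0 w1 wq]]] := qs _ eps0.
exists m.+1, (fun j => if j is i.+1 then w i else 0); split.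
- by case.
- by rewrite big_ord_recl/= add0r.
- by case=> [|j] jm; [rewrite mul0r | exact: wq].
Qed.

(** Small cost forces the weight at [0] to be at most [1/2], so the other weights
    can be renormalized at the price of a factor [2].  This needs [q 0 > 0]: a
    single infinite term could be the only reason for divergence. *)
Lemma convexly_small_behead q : (forall j, 0 <= q j) -> 0 < q 0%N ->
  convexly_small q -> convexly_small (fun j => q j.+1).
Proof.
move=> q0 q00 qs eps eps0.
(* The second bound keeps the weight at [0] below [1/2]. *)
pose d := Num.min (eps / 2) (q 0%N / 2).
have d0 : 0 < d by rewrite lt_min !divr_gt0.
have [m [w [w0 w1 wq]]] := qs _ d0.
case: m => [|m] in w1 wq; first by move: w1; rewrite big_ord0; lra.
have w00 : w 0%N <= 1/2.
  have := wq 0%N isT; rewrite lt_min => /andP[_].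
  by rewrite -ltr_pdivlMr// mulrAC divff ?gt_eqF//; lra.
move: w1; rewrite big_ord_recl /= => w1.
set t := 1 - w 0%N.
have t0 : 0 < t by rewrite /t; lra.
exists m, (fun j => w j.+1 / t); split.
- by move=> j; rewrite divr_ge0// ltW.
- rewrite -mulr_suml (_ : \sum_(i < m) w i.+1 = t) ?divff ?gt_eqF//.
  by rewrite /t -w1 addrC addKr.
- move=> j jm; rewrite mulrAC ltr_pdivrMr//.
  have := wq j.+1 jm; rewrite lt_min => /andP[+ _].
  move=> /lt_le_trans; apply; rewrite ler_wpM2l ?(ltW eps0)// /t; lra.
Qed.

End ConvexlySmall.

(** * The Baire category theorem and uniform boundedness *)

(** The metric is only assumed to induce the topology, so it is unrelated to the
    uniform structure of the space; the usual construction of shrinking balls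
    [c n] that avoid [F n] is carried out for the metric itself. *)
Lemma baire_closed_cover (R : realType) (X : topologicalType) (F : nat -> set X) :
  completely_metrizable R X -> [set: X] !=set0 ->
  (forall n, closed (F n)) -> (forall x, exists n, F n x) ->
  exists n (x : X), nbhs x (F n).
Proof.
move=> [d [[d0 d_eq0] dC dtri d_nbhs d_complete]] [x0 _] Fclosed Fcover.
apply: contrapT => Fint.
pose P (a : nat * (X * R)) (b : X * R) := 0 < a.2.2 ->
  [/\ 0 < b.2, b.2 <= a.1.+1%:R^-1
    & forall z, d b.1 z <= b.2 -> d a.2.1 z < a.2.2 /\ ~ F a.1 z].
have [f fP] : {f & forall a, P a (f a)}.
  apply: choice => -[n [x e]]; have [e0|] := pselect (0 < e); last first.
    by move=> e0; exists (x, e) => /e0.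
  have [y [xy Fy]] : exists y, d x y < e /\ ~ F n y.
    apply: contrapT => nex; apply: Fint; exists n, x.
    apply/d_nbhs; exists e => // y xy; apply: contrapT => Fy.
    by apply: nex; exists y.
  have : nbhs y (~` F n).
    by apply: open_nbhs_nbhs; split=> //; exact: closed_openC.
  move=> /d_nbhs [e1 e10 ye1].
  have exy : 0 < e - d x y by rewrite subr_gt0.
  have n0 : 0 < n.+1%:R^-1 :> R by rewrite invr_gt0.
  exists (y, Num.min (Num.min (e1 / 2) ((e - d x y) / 2)) n.+1%:R^-1) => _ /=.
  split.
  - by rewrite !lt_min n0 !divr_gt0.
  - by rewrite ge_min lexx orbT.
  - move=> z; rewrite !le_min => /andP[/andP[yz1 yz2] _]; split.
      by have := dtri x y z; lra.
    by apply: ye1 => /=; lra.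
pose fix c n := if n is m.+1 then f (m, c m) else (x0, 1 : R).
have c_gt0 n : 0 < (c n).2.
  by elim: n => [//|n IH] /=; have [] := fP (n, c n) IH.
have c_small n : (c n.+1).2 <= n.+1%:R^-1 by have [] := fP (n, c n) (c_gt0 n).
have c_in n z : d (c n.+1).1 z <= (c n.+1).2 ->
    d (c n).1 z < (c n).2 /\ ~ F n z.
  by have [_ _] := fP (n, c n) (c_gt0 n); exact.
have c_nest n m z : d (c (n + m)%N).1 z <= (c (n + m)%N).2 ->
    d (c n).1 z <= (c n).2.
  elim: m => [|m IH]; first by rewrite addn0.
  by rewrite addnS => /c_in [/ltW /IH].
have c_le n m : (n <= m)%N -> d (c n).1 (c m).1 <= (c n).2.
  move=> nm; apply: (c_nest n (m - n)%N); rewrite subnKC//.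
  by rewrite (iffRL (d_eq0 _ _))// ltW.
have [e e0|x cx] := d_complete (fun n => (c n).1).
  exists (Num.truncn (2 / e)).+1 => m n Nm Nn.
  apply: le_lt_trans (dtri _ (c (Num.truncn (2 / e)).+1).1 _) _.
  have : (c (Num.truncn (2 / e)).+1).2 < e / 2.
    apply: le_lt_trans (c_small _) _.
    by rewrite -[ltRHS]invrK ltf_pV2 ?posrE ?invr_gt0 ?divr_gt0// invf_div truncnS_gt.
  have := c_le _ _ Nm; have := c_le _ _ Nn; rewrite (dC (c m).1); lra.
have cx_le n : d (c n).1 x <= (c n).2.
  apply/ler_addgt0Pr => e e0.
  have : nbhs x [set y | d x y < e] by apply/d_nbhs; exists e.
  move=> /cx [N _ NP].
  have := NP (maxn N n) (leq_maxl _ _) => /=.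
  have := c_le _ _ (leq_maxr N n).
  have := dtri (c n).1 (c (maxn N n)).1 x.
  rewrite (dC (c (maxn N n)).1 x); lra.
by have [n Fn] := Fcover x; have [_] := c_in n x (cx_le n.+1).
Qed.

Section Seminorms.
Context {R : realType} {s : scalar_kind}.
Local Notation K := (scalar_field R s).
Context {X : lmodType K} {q : X -> R} (q_seminorm : seminorm q).

Lemma seminormD f g : q (f + g) <= q f + q g.
Proof. by case: q_seminorm. Qed.

Lemma seminormZ (a : K) f : q (a *: f) = modulus a * q f.
Proof. by case: q_seminorm. Qed.

Lemma seminorm0 : q 0 = 0.
Proof. by rewrite -(scale0r (0 : X)) seminormZ modulus0 mul0r. Qed.

Lemma seminormN f : q (- f) = q f.
Proof. by rewrite -scaleN1r seminormZ modulusN modulus1 mul1r. Qed.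

Lemma seminorm_ge0 f : 0 <= q f.
Proof. by have := seminormD f (- f); rewrite subrr seminorm0 seminormN; lra. Qed.

Lemma seminormB f g : q (f - g) <= q f + q g.
Proof. by rewrite -(seminormN g) seminormD. Qed.

Lemma seminorm_distC f g : q (f - g) = q (g - f).
Proof. by rewrite -seminormN opprB. Qed.

Lemma seminorm_sum (I : Type) (r : seq I) (F : I -> X) :
  q (\sum_(i <- r) F i) <= \sum_(i <- r) q (F i).
Proof.
apply: (big_ind2 (fun f t => q f <= t)) => [|x u y v xu yv|//].
  by rewrite seminorm0.
by apply: le_trans (seminormD _ _) _; exact: lerD.
Qed.

End Seminorms.

Section Domination.
Context {R : realType} {s : scalar_kind}.
Local Notation K := (scalar_field R s).
Context {X : tvsType K} {p : nat -> X -> R}.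
Hypothesis p_inducing : increasing_seminorms_inducing p.

Let p_seminorm k : seminorm (p k). Proof. by case: p_inducing. Qed.

Lemma inducing_le k l f : (k <= l)%N -> p k f <= p l f.
Proof.
case: p_inducing => _ p_incr _.
elim: l => [|l IH]; first by rewrite leqn0 => /eqP ->.
by rewrite leq_eqVlt => /predU1P[->//|kl]; exact: le_trans (IH kl) (p_incr _ _).
Qed.

Lemma nbhs_inducing f (A : set X) : nbhs f A <->
  exists k, exists2 r : R, 0 < r & [set g | p k (g - f) < r] `<=` A.
Proof. by case: p_inducing. Qed.

(** For a seminorm [q], this is continuity. *)
Definition dominated (q : X -> R) : Prop :=
  exists k C, 0 < C /\ forall f, q f <= C * p k f.

(** The vector [f] is rescaled to the radius [r]; as [p k f] may be zero, the
    rescaling uses radii slightly larger than [p k f]. *)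
Lemma dominated_bounded_ball (q : X -> R) k (r M : R) :
  seminorm q -> 0 < r -> 0 <= M -> (forall f, p k f < r -> q f <= M) ->
  forall f, q f <= M / r * p k f.
Proof.
move=> q_sn r0 M0 qM f.
have p0 : 0 <= p k f by exact: seminorm_ge0.
have step t : 0 < t -> p k f < t -> q f <= M / r * t.
  move=> t0 pt.
  have rt : 0 < r / t by rewrite divr_gt0.
  have := qM ((real_scalar (r / t)) *: f).
  rewrite !seminormZ// modulus_real_scalar ?(ltW rt)//.
  rewrite mulrAC ltr_pdivrMr// ltr_pM2l// => /(_ pt).
  rewrite -ler_pdivlMl// invf_div => /le_trans; apply.
  by rewrite mulrC mulrA mulrAC.
apply/ler_addgt0Pr => e e0.
have c0 : 0 < M / r + 1 by rewrite ltr_wpDl ?divr_ge0// ltW.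
have d0 : 0 < e / (M / r + 1) by rewrite divr_gt0.
apply: le_trans (step (p k f + e / (M / r + 1)) _ _) _.
- by rewrite ltr_wpDl.
- by rewrite ltrDl.
- rewrite mulrDr lerD2l mulrCA -[leRHS]mulr1 ler_wpM2l ?(ltW e0)//.
  by rewrite ler_pdivrMr// mul1r lerDl.
Qed.

(** The uniform boundedness principle.  The closed sets on which all [q i] are at
    most [n] cover the space, so one of them contains a ball; translating the
    ball to the origin costs a factor [2]. *)
Theorem uniform_domination (I : Type) (q : I -> X -> R) :
  frechet X -> (forall i, seminorm (q i)) -> (forall i, dominated (q i)) ->
  (forall f, exists M, forall i, q i f <= M) ->
  exists k C, 0 < C /\ forall i f, q i f <= C * p k f.
Proof.
move=> X_frechet q_sn q_dom q_bdd.
pose F (n : nat) := [set f : X | forall i, q i f <= n%:R].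
have Fclosed n : closed (F n).
  move=> f cf i.
  have [k [C [C0 qC]]] := q_dom i.
  apply/ler_addgt0Pr => e e0.
  have /cf [g [Fg /= gf]] : nbhs f [set g | p k (g - f) < e / C].
    by apply/nbhs_inducing; exists k, (e / C); rewrite ?divr_gt0.
  have := seminormD (q_sn i) g (f - g); rewrite subrKC => /le_trans; apply.
  apply: lerD; first exact: Fg.
  rewrite (le_trans (qC _))// mulrC -ler_pdivlMr// ltW//.
  by rewrite (seminorm_distC (p_seminorm k)).
have Fcover f : exists n, F n f.
  have [M qM] := q_bdd f; exists (Num.truncn M).+1 => i.
  by rewrite (le_trans (qM i))// ltW// truncnS_gt.
have X_inh : [set: X] !=set0 by exists 0.
have [n [f0]] := baire_closed_cover X_frechet X_inh Fclosed Fcover.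
move=> /nbhs_inducing [k [r r0 kr]].
exists k, (2 * n%:R / r + 1); split.
  by rewrite ltr_wpDl// divr_ge0 ?mulr_ge0// ltW.
move=> i f.
have pk0 : 0 <= p k f by exact: seminorm_ge0.
rewrite mulrDl mul1r ler_wpDr//.
apply: dominated_bounded_ball => // g gr.
have Ff0 : F n f0 by apply: kr => /=; rewrite subrr seminorm0.
have Fg : F n (f0 + g) by apply: kr => /=; rewrite addrAC subrr add0r.
have := seminormB (q_sn i) (f0 + g) f0; rewrite addrAC subrr add0r.
have := Ff0 i; have := Fg i; lra.
Qed.

End Domination.
Arguments dominated {R s X} p q.

(** * The translation-invariant metric and the seminorms *)

(** Chains are measured by [fnorm], which is not homogeneous; a single
    seminorm, which is, can take its place up to changing the size of the errors. *)
Section FNorm.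
Context {R : realType} {s : scalar_kind}.
Local Notation K := (scalar_field R s).
Context {X : tvsType K} {p : nat -> X -> R}.
Hypothesis p_inducing : increasing_seminorms_inducing p.

Let p_seminorm k : seminorm (p k). Proof. by case: p_inducing. Qed.
Let p_ge0 k f : 0 <= p k f. Proof. exact: seminorm_ge0. Qed.

Let term (f : X) (k : nat) : R := 2^-1 ^+ k.+1 * Num.min 1 (p k f).

Let half_gt0 k : 0 < 2^-1 ^+ k :> R.
Proof. by rewrite exprn_gt0// invr_gt0. Qed.

Let term_ge0 f k : 0 <= term f k.
Proof. by rewrite mulr_ge0 ?(ltW (half_gt0 _))// le_min ler01 p_ge0. Qed.

Let series_le f k n : series (term f) n <= p k f + 2^-1 ^+ k.+1.
Proof.
have head m : (m <= k.+1)%N -> series (term f) m <= (1 - 2^-1 ^+ m) * p k f.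
  elim: m => [|m IH] mk; first by rewrite /series/= big_geq// expr0 subrr mul0r.
  have -> : series (term f) m.+1 = series (term f) m + term f m.
    by rewrite /series/= big_nat_recr.
  have : term f m <= 2^-1 ^+ m.+1 * p k f.
    rewrite ler_wpM2l ?(ltW (half_gt0 _))//.
    apply: le_trans (inducing_le p_inducing _ (mk : (m <= k)%N)).
    by rewrite ge_min lexx orbT.
  have := IH (ltnW mk); rewrite (exprS _ m); lra.
have tail m : series (term f) (k.+1 + m)%N <= p k f + 2^-1 ^+ k.+1 - 2^-1 ^+ (k.+1 + m).
  elim: m => [|m IH].
    rewrite addn0 addrK; apply: le_trans (head _ (leqnn _)) _.
    by rewrite ler_piMl// gerBl ltW.
  have -> : series (term f) (k.+1 + m.+1)%N =
      series (term f) (k.+1 + m)%N + term f (k.+1 + m)%N.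
    by rewrite /series/= addnS big_nat_recr.
  have : term f (k.+1 + m)%N <= 2^-1 ^+ (k.+1 + m).+1.
    by rewrite ler_piMr ?(ltW (half_gt0 _))// ge_min lexx.
  rewrite addnS (exprS _ (k.+1 + m)); lra.
have [nk|kn] := leqP n k.+1.
  apply: le_trans (head _ nk) _; rewrite ler_wpDr ?(ltW (half_gt0 _))//.
  by rewrite ler_piMl// gerBl ltW.
by rewrite -(subnKC (ltnW kn)); apply: le_trans (tail _) _; rewrite gerBl ltW.
Qed.

Let term_nd f : nondecreasing_seq (series (term f)).
Proof. by apply: (@nondecreasing_series _ (term f) xpredT 0%N) => n _ _; exact: term_ge0. Qed.

Let term_cvg f : cvgn (series (term f)).
Proof.
apply: nondecreasing_is_cvgn; first exact: term_nd.
by exists (p 0%N f + 2^-1 ^+ 1) => _ [n _ <-]; exact: series_le.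
Qed.

Lemma fnorm_le k f : fnorm p f <= p k f + 2^-1 ^+ k.+1.
Proof.

apply: (limr_le (@term_cvg f)); apply: nearW => n; exact: series_le.
Qed.

Lemma fnorm_ge k f : 2^-1 ^+ k.+1 * Num.min 1 (p k f) <= fnorm p f.
Proof.
apply: le_trans (nondecreasing_cvgn_le (@term_nd f) (@term_cvg f) k.+1).
rewrite /series/= big_nat_recr//= lerDr; apply: sumr_ge0 => i _.
exact: term_ge0.
Qed.

Lemma small_seminorm_small_fnorm (delta : R) : 0 < delta ->
  exists k, exists2 r : R, 0 < r & forall f, p k f < r -> fnorm p f < delta.
Proof.
move=> delta0.
have [k kd] : exists k, 2^-1 ^+ k.+1 < delta / 2 :> R.
  have : 2^-1 ^+ n @[n --> \oo] --> (0 : R).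
    by apply: cvg_expr; rewrite ger0_norm ?invr_ge0// invf_lt1// ltr1n.
  move/cvgrPdist_lt/(_ (delta / 2)) => [|N _ NP]; first by rewrite divr_gt0.
  exists N; have := NP N.+1 (leqnSn N).
  by rewrite /= sub0r normrN gtr0_norm.
exists k, (delta / 2); first by rewrite divr_gt0.
by move=> f fk; have := fnorm_le k f; lra.
Qed.

Lemma small_fnorm_small_seminorm k (r : R) : 0 < r ->
  exists2 delta : R, 0 < delta & forall f, fnorm p f < delta -> p k f < r.
Proof.
move=> r0; exists (2^-1 ^+ k.+1 * Num.min 1 r).
  by rewrite mulr_gt0// lt_min ltr01.
move=> f /(le_lt_trans (fnorm_ge k f)); rewrite ltr_pM2l//.
rewrite lt_min !gt_min ltxx /=; case/andP => p1.
by case/orP => // /(lt_trans p1).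
Qed.

End FNorm.

(** * The unweighted model of a weighted shift *)

Section DominationClosure.
Context {R : realType} {s : scalar_kind}.
Local Notation K := (scalar_field R s).
Context {X : tvsType K} {p : nat -> X -> R}.
Hypothesis p_inducing : increasing_seminorms_inducing p.

Let p_ge0 k f : 0 <= p k f.
Proof. by apply: seminorm_ge0; case: p_inducing. Qed.

Lemma dominated_le (q q' : X -> R) :
  (forall f, q f <= q' f) -> dominated p q' -> dominated p q.
Proof.
by move=> qq [k [C [C0 qC]]]; exists k, C; split=> // f; exact: le_trans (qC f).
Qed.

Lemma dominatedD (q q' : X -> R) :
  dominated p q -> dominated p q' -> dominated p (fun f => q f + q' f).
Proof.
move=> [k [C [C0 qC]]] [k' [C' [C'0 qC']]].
exists (maxn k k'), (C + C'); split=> [|f]; first exact: addr_gt0.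
rewrite mulrDl lerD//.
  apply: le_trans (qC f) _; rewrite ler_wpM2l ?(ltW C0)//.
  by rewrite (inducing_le p_inducing)// leq_maxl.
apply: le_trans (qC' f) _; rewrite ler_wpM2l ?(ltW C'0)//.
by rewrite (inducing_le p_inducing)// leq_maxr.
Qed.

Lemma dominated0 : dominated p (fun=> 0).
Proof. by exists 0%N, 1; split=> // f; rewrite mul1r. Qed.

Lemma dominatedZ (c : R) (q : X -> R) :
  0 <= c -> dominated p q -> dominated p (fun f => c * q f).
Proof.
move=> c0 [k [C [C0 qC]]]; exists k, ((c + 1) * C); split=> [|f].
  by rewrite mulr_gt0// ltr_wpDl.
rewrite -mulrA mulrDl mul1r ler_wpDr ?mulr_ge0 ?(ltW C0)//.
exact: ler_wpM2l.
Qed.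

Lemma dominated_sum (I : Type) (r : seq I) (q : I -> X -> R) :
  (forall i, dominated p (q i)) -> dominated p (fun f => \sum_(i <- r) q i f).
Proof.
move=> q_dom; elim: r => [|i r IH].
  by apply: dominated_le dominated0 => f; rewrite big_nil.
by apply: dominated_le (dominatedD (q_dom i) IH) => f; rewrite big_cons.
Qed.

End DominationClosure.

Section ShiftModel.
Context {R : realType} {s : scalar_kind} (V : index_kind).
Local Notation K := (scalar_field R s).
Context {X : tvsType K} (p : nat -> X -> R).
Variables (phi : int -> {scalar X}) (h : int -> X).

Definition partial_sum (N : nat) (f : X) : X :=
  \sum_(i < N.*2.+1) phi (i%:Z - N%:Z) f *: h (i%:Z - N%:Z).

(** The difference of two consecutive symmetric partial sums. *)
Definition block (N : nat) (f : X) : X :=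
  if N is N'.+1 then phi N%:Z f *: h N%:Z + phi (- N%:Z) f *: h (- N%:Z)
  else phi 0 f *: h 0.

(** What remains of a weighted shift after the rescaling: a backward shift
    without weights, with coordinates [phi], on the vectors [h].  Both families
    are extended by zero to all integers, so that [shift_h] holds at every
    integer, also at the left end of the positive integers; [phi_shift] fails
    there at [0], where its right-hand side is the first coordinate. *)
Record shift_model (B : {linear X -> X}) : Prop := ShiftModel {
  phi_h : forall n m, in_index V n -> phi n (h m) = (n == m)%:R;
  phi_out : forall n f, ~~ in_index V n -> phi n f = 0;
  h_out : forall n, ~~ in_index V n -> h n = 0;
  shift_h : forall n, B (h n) = h (n - 1);
  phi_shift : forall n f, in_index V n -> phi n (B f) = phi (n + 1) f;
  phi_dominated : forall n, dominated p (fun f => modulus (phi n f));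
  phi_total : forall f, (forall n, phi n f = 0) -> f = 0;
  expansion : forall f k (eps : R), 0 < eps ->
    exists N0, forall N, (N0 <= N)%N -> p k (partial_sum N f - f) < eps
}.

Lemma partial_sumS N f : partial_sum N.+1 f = partial_sum N f + block N.+1 f.
Proof.
rewrite /partial_sum doubleS big_ord_recr big_ord_recl /=.
have -> : N.*2.+2%:Z - N.+1%:Z = N.+1%:Z by lia.
have -> : 0%:Z - N.+1%:Z = - N.+1%:Z by lia.
rewrite [in RHS](addrC (phi N.+1%:Z f *: _)) addrA; congr (_ + _).
rewrite addrC; congr (_ + _); apply: eq_bigr => i _.
by rewrite /bump/= (_ : (1 + i)%:Z - N.+1%:Z = i%:Z - N%:Z)//; lia.
Qed.

Lemma partial_sum0 f : partial_sum 0 f = block 0 f.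
Proof. by rewrite /partial_sum big_ord1. Qed.

Lemma partial_sumP N a f g :
  partial_sum N (a *: f + g) = a *: partial_sum N f + partial_sum N g.
Proof.
rewrite /partial_sum scaler_sumr -big_split/=; apply: eq_bigr => i _.
by rewrite linearP/= scalerDl scalerA.
Qed.

Hypothesis p_inducing : increasing_seminorms_inducing p.
Hypothesis X_frechet : frechet X.
Context {B : {linear X -> X}}.
Hypothesis B_model : shift_model B.

Let p_seminorm k : seminorm (p k). Proof. by case: p_inducing. Qed.
Let p_ge0 k f : 0 <= p k f. Proof. exact: seminorm_ge0. Qed.

Lemma partial_sum_seminorm (T : {linear X -> X}) k N :
  seminorm (fun f => p k (partial_sum N (T f))).
Proof.
split=> [f g|a f].
  by have := partial_sumP N 1 (T f) (T g); rewrite !scale1r -linearD => ->; exact: seminormD.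
have := partial_sumP N a (T f) (T 0); rewrite linear0 addr0 linearZ/= => ->.
have -> : partial_sum N 0 = 0.
  by rewrite /partial_sum big1// => i _; rewrite linear0 scale0r.
by rewrite addr0; exact: seminormZ.
Qed.

(** Used with the identity and with the shift itself, whose continuity is not
    yet known: it suffices that each coordinate of [T f] is continuous. *)
Lemma partial_sum_equicontinuous (T : {linear X -> X}) :
  (forall n, dominated p (fun f => modulus (phi n (T f)))) ->
  forall k, exists k' C, 0 < C /\
    forall N f, p k (partial_sum N (T f)) <= C * p k' f.
Proof.
move=> T_dom k; apply: (uniform_domination p_inducing X_frechet).
- by move=> N; exact: partial_sum_seminorm.
- move=> N; apply: (@dominated_le _ _ _ _ _ (fun f => \sum_(i < N.*2.+1)
      p k (h (i%:Z - N%:Z)) * modulus (phi (i%:Z - N%:Z) (T f)))).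
    move=> f; apply: le_trans (seminorm_sum (p_seminorm k) _ _) _.
    by apply: ler_sum => i _; rewrite seminormZ// mulrC.
  by apply: dominated_sum => // i; exact: dominatedZ.
- move=> f; have [N0 N0P] := expansion B_model (T f) k ltr01.
  exists (\sum_(N < N0) p k (partial_sum N (T f)) + (p k (T f) + 1)) => N.
  have [NN|NN] := ltnP N N0.
    rewrite (bigD1 (Ordinal NN))//= -addrA lerDl addr_ge0//.
      by apply: sumr_ge0.
    by rewrite addr_ge0.
  rewrite ler_wpDl ?sumr_ge0//.
  have := seminormD (p_seminorm k) (partial_sum N (T f) - T f) (T f).
  by rewrite subrK => /le_trans; apply; rewrite addrC lerD2l ltW// N0P.
Qed.

Lemma shift_phi_dominated n : dominated p (fun f => modulus (phi n (B f))).
Proof.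
have [nV|nV] := boolP (in_index V n); last first.
  apply: dominated_le (dominated0 p_inducing) => f.
  by rewrite (phi_out B_model _ nV) modulus0.
by apply: dominated_le (phi_dominated B_model (n + 1)) => f; rewrite (phi_shift B_model).
Qed.

(** The operators obtained by truncating [B f] are continuous, since they only
    involve finitely many coordinates, and they converge pointwise to [B].  The
    uniform boundedness principle makes their bounds independent of the
    truncation, and these bounds pass to the limit. *)
Lemma shift_continuous k :
  exists k' C, 0 < C /\ forall f, p k (B f) <= C * p k' f.
Proof.
have [k' [C [C0 BC]]] := partial_sum_equicontinuous shift_phi_dominated k.
exists k', C; split=> // f; apply/ler_addgt0Pr => e e0.
have [N NP] := expansion B_model (B f) k e0.
have := seminormD (p_seminorm k) (partial_sum N (B f)) (B f - partial_sum N (B f)).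
rewrite subrKC => /le_trans; apply; apply: lerD => //.
by rewrite seminorm_distC// ltW// NP.
Qed.

Lemma block_equicontinuous (T : {linear X -> X}) :
  (forall n, dominated p (fun f => modulus (phi n (T f)))) ->
  forall k, exists k' C, 0 < C /\ forall N f, p k (block N (T f)) <= C * p k' f.
Proof.
move=> T_dom k.
have [k' [C [C0 TC]]] := partial_sum_equicontinuous T_dom k.
exists k', (C + C); split=> [|[|N] f]; first exact: addr_gt0.
  rewrite -partial_sum0 mulrDl ler_wpDr//; apply: mulr_ge0 => //; exact: ltW.
have -> : block N.+1 (T f) = partial_sum N.+1 (T f) - partial_sum N (T f).
  by rewrite partial_sumS addrAC subrr add0r.
by apply: le_trans (seminormB (p_seminorm k) _ _) _; rewrite mulrDl lerD.
Qed.

Lemma phi_block m N f : phi m (block N f) = if `|m|%N == N then phi m f else 0.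
Proof.
have [mV|mV] := boolP (in_index V m); last first.
  by rewrite !(phi_out B_model _ mV) if_same.
case: N => [|N] /=; rewrite ?linearD !linearZ/= !(phi_h B_model)//.
  by rewrite absz_eq0; case: eqVneq => [->|_]; rewrite ?mulr1 ?mulr0.
have [mN|mN] := eqVneq `|m|%N N.+1.
  have [e|e] : m = N.+1%:Z \/ m = - N.+1%:Z by lia.
    rewrite e eqxx mulr1 (_ : (_ == _) = false) ?mulr0 ?addr0//; lia.
  rewrite e eqxx mulr1 (_ : (_ == _) = false) ?mulr0 ?add0r//; lia.
rewrite (_ : (m == _) = false); last lia.
by rewrite (_ : (m == _) = false) ?mulr0 ?addr0//; lia.
Qed.

(** The image under [B] of the block [{n, - n}] has its coordinates at [n - 1] and
    [- n - 1], and only [n - 1] belongs to the block [{n - 1, 1 - n}] (for [n = 0]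
    both are the same).  This is how one coordinate is isolated although the
    partial sums are symmetric. *)
Lemma block_shift_block n f :
  block `|(n - 1)%R|%N (B (block `|n|%N f)) = phi n f *: h (n - 1).
Proof.
have coord m : phi m (B (block `|n|%N f)) *: h m =
    (if `|(m + 1)%R|%N == `|n|%N then phi (m + 1) f else 0) *: h m.
  have [mV|mV] := boolP (in_index V m); last by rewrite (h_out B_model mV) !scaler0.
  by rewrite (phi_shift B_model)// phi_block.
case E : `|(n - 1)%R|%N => [|N] /=; rewrite !coord.
  by have -> : n = 1 by lia.
have [e|e] : n - 1 = N.+1%:Z \/ n - 1 = - N.+1%:Z by lia.
  rewrite -e subrK eqxx (_ : (`|(- (n - 1) + 1)%R|%N == _) = false) ?scale0r ?addr0//.
  lia.
rewrite -e subrK eqxx (_ : (`|(N.+1%:Z + 1)%R|%N == _) = false) ?scale0r ?add0r//.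
lia.
Qed.

(** For partial sums that add one index at a time, this would hold with [h n]
    instead of [h (n - 1)].  The difference does not matter for the series, in
    which it only changes the first term. *)
Lemma shifted_coordinate_bound k :
  exists k' C, 0 < C /\ forall n f, modulus (phi n f) * p k (h (n - 1)) <= C * p k' f.
Proof.
have [k1 [C1 [C10 B1]]] := block_equicontinuous shift_phi_dominated k.
have [k2 [C2 [C20 B2]]] :=
  block_equicontinuous (T := idfun) (fun n => phi_dominated B_model n) k1.
exists k2, (C1 * C2); split=> [|n f]; first exact: mulr_gt0.
rewrite -(seminormZ (p_seminorm k)) -block_shift_block (le_trans (B1 _ _))//.
by rewrite -mulrA ler_pM2l//; exact: (B2 `|n|%N f).
Qed.

End ShiftModel.

(** * Chains as sums of propagated errors *)

Section PropagatedErrors.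
Context {R : realType} {s : scalar_kind}.
Local Notation K := (scalar_field R s).
Context {X : tvsType K} (p : nat -> X -> R) (B : {linear X -> X}).
Hypothesis p_inducing : increasing_seminorms_inducing p.

Let p_seminorm k : seminorm (p k). Proof. by case: p_inducing. Qed.

(** The end points of the chains of length [m] that start at [0], the error [g j]
    being made [j] steps before the end. *)
Definition propagated_errors (k : nat) (r : R) (m : nat) : set X :=
  [set f | exists g : nat -> X, (forall j, (j < m)%N -> p k (g j) < r) /\
     f = \sum_(j < m) iter j B (g j)].

Local Notation errs := propagated_errors.

Lemma iter_linearP m a f g :
  iter m B (a *: f + g) = a *: iter m B f + iter m B g.
Proof. by elim: m => //= m ->; rewrite linearP. Qed.

Lemma iter_linearD m f g : iter m B (f + g) = iter m B f + iter m B g.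
Proof. by have := iter_linearP m 1 f g; rewrite !scale1r. Qed.

Lemma iter_linear0 m : iter m B 0 = 0.
Proof. by elim: m => //= m ->; rewrite linear0. Qed.

Lemma iter_linearZ m a f : iter m B (a *: f) = a *: iter m B f.
Proof. by have := iter_linearP m a f 0; rewrite iter_linear0 !addr0. Qed.

Lemma iter_linearN m f : iter m B (- f) = - iter m B f.
Proof. by rewrite -scaleN1r iter_linearZ scaleN1r. Qed.

Lemma iter_linear_sum m (I : Type) (r : seq I) (F : I -> X) :
  iter m B (\sum_(i <- r) F i) = \sum_(i <- r) iter m B (F i).
Proof. exact: (big_morph _ (iter_linearD m) (iter_linear0 m)). Qed.

Lemma errors0 k r m : 0 < r -> errs k r m 0.
Proof.
move=> r0; exists (fun=> 0); split=> [j _|]; first by rewrite seminorm0.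
by rewrite big1// => j _; rewrite iter_linear0.
Qed.

Lemma errorsD k r r' m f f' :
  errs k r m f -> errs k r' m f' -> errs k (r + r') m (f + f').
Proof.
move=> [g [gr ->]] [g' [gr' ->]]; exists (fun j => g j + g' j); split.
  move=> j jm; apply: le_lt_trans (seminormD (p_seminorm k) _ _) _.
  by rewrite ltrD ?gr ?gr'.
by rewrite -big_split/=; apply: eq_bigr => j _; rewrite iter_linearD.
Qed.

Lemma errorsZ k r r' m a f :
  modulus a * r < r' -> errs k r m f -> errs k r' m (a *: f).
Proof.
move=> ar [g [gr ->]]; exists (fun j => a *: g j); split.
  move=> j jm; rewrite seminormZ//; apply: le_lt_trans ar.
  by rewrite ler_wpM2l ?modulus_ge0// ltW// gr.
by rewrite scaler_sumr; apply: eq_bigr => j _; rewrite iter_linearZ.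
Qed.

(** Concatenation of chains: the errors of the first one are propagated [n] more
    times. *)
Lemma errors_cat k r m n f g :
  errs k r m f -> errs k r n g -> errs k r (n + m) (g + iter n B f).
Proof.
move=> [u [ur ->]] [v [vr ->]].
exists (fun j => if (j < n)%N then v j else u (j - n)%N); split=> [j jnm|].
  by case: ltnP => jn; [exact: vr | apply: ur; lia].
rewrite big_split_ord/= iter_linear_sum; congr (_ + _); apply: eq_bigr => j _.
  by rewrite ltn_ord.
by rewrite ltnNge leq_addr/= addKn iterD.
Qed.

Lemma errors_iter k r m n f :
  0 < r -> errs k r m f -> errs k r (n + m) (iter n B f).
Proof. by move=> r0 fm; have := errors_cat fm (errors0 k n r0); rewrite add0r. Qed.

Lemma errors_widen k r m n f :
  0 < r -> (m <= n)%N -> errs k r m f -> errs k r n f.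
Proof.
move=> r0 mn fm; have := errors_cat (errors0 k (n - m) r0) fm.
by rewrite iter_linear0 addr0 subnKC.
Qed.

Lemma errors_single k r m j f :
  (j < m)%N -> p k f < r -> errs k r m (iter j B f).
Proof.
move=> jm fr; have r0 : 0 < r by apply: le_lt_trans fr; exact: seminorm_ge0.
 apply: (@errors_widen _ _ (j + 1)) => //; first by lia.
apply: errors_iter => //; exists (fun=> f); split=> //.
by rewrite big_ord1.
Qed.

Lemma pseudo_orbitE m (c : nat -> X) :
  c m = iter m B (c 0%N) +
    \sum_(j < m) iter j B (c (m - j)%N - B (c (m - j).-1)).
Proof.
elim: m => [|m IH]; first by rewrite big_ord0 addr0.
rewrite big_ord_recl/= addrCA -[LHS](subrK (B (c m))); congr (_ + _).
by rewrite [in LHS]IH linearD linear_sum.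
Qed.

Lemma chain_recurrentP f : CR p B f <->
  forall k r, 0 < r -> exists m, (1 <= m)%N /\ errs k r m (f - iter m B f).
Proof.
split=> [f_cr k r r0|f_err delta delta0].
  have [delta delta0 small] := small_fnorm_small_seminorm p_inducing k r0.
  have [m [c [m1 c0 cm c_err]]] := f_cr _ delta0.
  exists m; split=> //; exists (fun j => c (m - j)%N - B (c (m - j).-1)); split.
    by move=> j jm; apply/small/c_err; lia.
  have E := pseudo_orbitE m c; rewrite c0 cm in E.
  by rewrite [X in X - _]E addrAC subrr add0r.
have [k [r r0 small]] := small_seminorm_small_fnorm p_inducing delta0.
have [m [m1 [g [gr fE]]]] := f_err k r r0.
pose fix c n := if n is l.+1 then B (c l) + g (m - n)%N else f.
exists m, c; split=> //.
  rewrite pseudo_orbitE -[RHS](subrK (iter m B f)) fE addrC; congr (_ + _).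
  apply: eq_bigr => -[j jm] _; congr iter => /=.
  case E : (m - j)%N => [|l]; first by lia.
  by rewrite /= addrAC subrr add0r; congr g; lia.
case=> [//|l] lm; apply: small.
by rewrite /= addrAC subrr add0r gr//; lia.
Qed.

(** Running through a closed chain [i] times. *)
Lemma errors_return k r m i f : 0 < r ->
  errs k r m (f - iter m B f) -> errs k r (i * m) (f - iter (i * m) B f).
Proof.
move=> r0 fm; elim: i => [|i IH].
  by rewrite mul0n subrr; exact: errors0.
have := errors_cat IH fm; rewrite mulSn; congr errs.
by rewrite iter_linearD iter_linearN -iterD addrA subrK.
Qed.

End PropagatedErrors.

(** * Independence of the base index *)

Section Equivalence.
Context {R : realType} {s : scalar_kind} {V : index_kind}.
Local Notation K := (scalar_field R s).
Context {X : tvsType K} {p : nat -> X -> R}.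
Context {phi : int -> {scalar X}} {h : int -> X} {B : {linear X -> X}}.
Hypothesis p_inducing : increasing_seminorms_inducing p.
Hypothesis X_frechet : frechet X.
Hypothesis B_model : shift_model V p phi h B.

Let p_seminorm k : seminorm (p k). Proof. by case: p_inducing. Qed.
Let p_ge0 k f : 0 <= p k f. Proof. exact: seminorm_ge0. Qed.

Local Notation errs := (propagated_errors p B).

Lemma iter_shift_h m n : iter m B (h n) = h (n - m%:Z).
Proof.
elim: m => [|m IH]; first by rewrite subr0.
by rewrite /= IH (shift_h B_model); congr h; lia.
Qed.

Lemma in_indexD n m : in_index V n -> in_index V (n + m%:Z).
Proof. by case: V => //=; lia. Qed.

Lemma phi_iter_shift m n f : in_index V n -> phi n (iter m B f) = phi (n + m%:Z) f.
Proof.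
elim: m n => [|m IH] n nV; first by rewrite addr0.
rewrite /= (phi_shift B_model)// IH; last exact: (@in_indexD n 1).
by congr (phi _ f); lia.
Qed.

Definition model_divergence (n0 : int) : Prop := forall k,
  convexly_small (fun j => p k (h (n0 + j.+1%:Z))) /\
  (V = Bilateral -> convexly_small (fun j => p k (h (n0 - j.+1%:Z)))).

(** The first reciprocal may be infinite for the given seminorm, but not for a
    larger seminorm that does not vanish at [v 0]; divergence for the larger
    seminorm is the stronger property. *)
Lemma small_behead (v : nat -> X) : (exists k, 0 < p k (v 0%N)) ->
  (forall k, convexly_small (fun j => p k (v j))) ->
  forall k, convexly_small (fun j => p k (v j.+1)).
Proof.
move=> [k0 v0] vs k.
apply: (convexly_small_le (q := fun j => p (maxn k k0) (v j.+1))).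
  by move=> j; rewrite (inducing_le p_inducing)// leq_maxl.
apply: (convexly_small_behead (q := fun j => p (maxn k k0) (v j))) => //.
by apply: lt_le_trans v0 _; rewrite (inducing_le p_inducing)// leq_maxr.
Qed.

Lemma h_seminorm_gt0 n : in_index V n -> exists k, 0 < p k (h n).
Proof.
move=> nV; have [k [C [C0 /(_ (h n))]]] := phi_dominated B_model n.
rewrite (phi_h B_model)// eqxx modulus1 => pC; exists k.
rewrite lt_def p_ge0 andbT; apply/eqP => ph; move: pC; rewrite ph mulr0; lra.
Qed.

Lemma model_divergenceS n : in_index V (n + 1) ->
  model_divergence n <-> model_divergence (n + 1).
Proof.
move=> nV.
have fwd j : n + 1 + j.+1%:Z = n + j.+2%:Z by lia.
have bwd j : n - j.+1%:Z = n + 1 - j.+2%:Z by lia.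
split=> n_div k; split.
- have := @small_behead (fun j => h (n + j.+1%:Z)) (h_seminorm_gt0 nV)
      (fun k => (n_div k).1) k.
  by apply: convexly_small_le => j; rewrite fwd.
- move=> VB; apply: convexly_small_cons.
  by apply: convexly_small_le ((n_div k).2 VB) => j; rewrite bwd.
- apply: convexly_small_cons.
  by apply: convexly_small_le ((n_div k).1) => j; rewrite fwd.
- move=> VB; have nV' : in_index V (n + 1 - 1%:Z) by rewrite VB.
  have := @small_behead (fun j => h (n + 1 - j.+1%:Z)) (h_seminorm_gt0 nV')
      (fun k => (n_div k).2 VB) k.
  by apply: convexly_small_le => j; rewrite bwd.
Qed.

Lemma model_divergence_indep n n' :
  (n == 0) || in_index V n -> (n' == 0) || in_index V n' ->
  model_divergence n -> model_divergence n'.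
Proof.
suff base m : (m == 0) || in_index V m -> model_divergence 0 <-> model_divergence m.
  by move=> /base nP /base n'P /nP /n'P.
case: m => m mV; elim: m mV => [//|m IH] mV.
- have mV' : (m%:Z == 0) || in_index V m%:Z by move: mV; case: V => //=; lia.
  have step : in_index V (m%:Z + 1) by case: V => //=; lia.
  rewrite IH// (_ : m.+1 = m + 1 :> int); last by lia.
  exact: model_divergenceS.
- by rewrite (model_divergenceS (n := Negz 0)) //; case: V mV.
- have VB : V = Bilateral by move: mV; case: V.
  rewrite IH; last by rewrite VB.
  rewrite (_ : Negz m = Negz m.+1 + 1); last by lia.
  by symmetry; apply: model_divergenceS; rewrite VB.
Qed.

(** * Divergence implies chain recurrence *)

(** The first condition says that [f] is reached from [0].  The second one says
    that [0] is reached from [f]: the signs of the errors may be changed, so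
    [B^m f] can be cancelled.  Asking for both at all large lengths makes the
    set of these vectors closed under addition. *)
Definition linked_to_zero (f : X) : Prop := forall k r, 0 < r ->
  exists m0, forall m, (m0 <= m)%N -> errs k r m f /\ errs k r m (iter m B f).

Lemma linked0 : linked_to_zero 0.
Proof.
move=> k r r0; exists 0%N => m _; rewrite iter_linear0.
by split; exact: errors0.
Qed.

Lemma linkedD f g : linked_to_zero f -> linked_to_zero g -> linked_to_zero (f + g).
Proof.
move=> lf lg k r r0; have r20 : 0 < r / 2 by rewrite divr_gt0.
have [m fm] := lf k _ r20; have [n gn] := lg k _ r20.
exists (maxn m n) => i; rewrite geq_max => /andP[/fm [f1 f2] /gn [g1 g2]].
have -> : r = r / 2 + r / 2 by lra.
by rewrite iter_linearD; split; exact: errorsD.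
Qed.

Lemma linkedZ a f : linked_to_zero f -> linked_to_zero (a *: f).
Proof.
move=> lf k r r0.
have a1 : 0 < modulus a + 1 by rewrite ltr_wpDl// modulus_ge0.
have [m fm] := lf k _ (divr_gt0 r0 a1).
have ar : modulus a * (r / (modulus a + 1)) < r.
  by rewrite mulrCA -[ltRHS]mulr1 ltr_pM2l// ltr_pdivrMr// mul1r ltrDl.
exists m => i /fm [f1 f2]; rewrite iter_linearZ.
by split; apply: errorsZ ar _.
Qed.

Lemma convex_combination m (w : nat -> R) (f : X) : \sum_(j < m) w j = 1 ->
  f = \sum_(j < m) real_scalar (w j) *: f.
Proof. by move=> w1; rewrite -scaler_suml -real_scalar_sum w1 real_scalar1 scale1r. Qed.

(** The convex weights come from the forward series for the first condition and
    from the backward series for the second one; on the positive integers the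
    second one holds because the orbit of [h n] reaches [0]. *)
Lemma linked_h n : model_divergence n -> in_index V n -> linked_to_zero (h n).
Proof.
move=> n_div nV k r r0.
have [m1 E1] : exists m, errs k r m (h n).
  have [m [w [w0 w1 wr]]] := (n_div k).1 r r0.
  exists m.+1; exists (fun j => if j is i.+1 then real_scalar (w i) *: h (n + i.+1%:Z) else 0).
  split=> [[_|j jm]|].
  - by rewrite seminorm0.
  - by rewrite seminormZ// modulus_real_scalar// wr.
  rewrite big_ord_recl/= add0r [LHS](convex_combination _ w1).
  apply: eq_bigr => j _; rewrite /bump/= -iterS iter_linearZ iter_shift_h.
  by rewrite addrK.
have [m2 E2] : exists m, errs k r m (iter m B (h n)).
  case VE : V nV => [|] nV.
    exists `|n|%N; rewrite iter_shift_h (h_out B_model); first exact: errors0.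
    by rewrite VE /= in nV *; lia.
  have [m [w [w0 w1 wr]]] := (n_div k).2 VE r r0.
  exists m; exists (fun i => real_scalar (w (m - i.+1)%N) *: h (n - (m - i)%N%:Z)); split.
    move=> j jm; rewrite seminormZ// modulus_real_scalar//.
    have := wr (m - j.+1)%N; rewrite -subSn// subSS; apply; lia.
  rewrite iter_shift_h [LHS](convex_combination _ w1) (reindex_inj rev_ord_inj)/=.
  apply: eq_bigr => j _; rewrite iter_linearZ iter_shift_h.
  by congr (_ *: h _); have := ltn_ord j; lia.
exists (maxn m1 m2) => m; rewrite geq_max => /andP[m1m m2m]; split.
  exact: errors_widen E1.
have := errors_iter p_inducing (m - m2)%N r0 E2.
by rewrite subnK// -iterD subnK.
Qed.

(** The partial sums of [f] are linked to [0], and the remaining difference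
    [f - g] is absorbed by a single error: at the end of the chain for the first
    condition, and, after one application of [B], at its beginning for the
    second.  The latter uses the continuity of [B]. *)
Lemma linked_all : (forall n, in_index V n -> model_divergence n) ->
  forall f, linked_to_zero f.
Proof.
move=> V_div.
have linked_h' n : linked_to_zero (h n).
  have [nV|nV] := boolP (in_index V n); first exact: linked_h (V_div n nV) nV.
  by rewrite (h_out B_model nV); exact: linked0.
move=> f k r r0; have r20 : 0 < r / 2 by rewrite divr_gt0.
have [k' [C [C0 BC]]] := shift_continuous p_inducing X_frechet B_model k.
have rC : 0 < r / 2 / C by rewrite divr_gt0.
have [N1 N1P] := expansion B_model f k r20.
have [N2 N2P] := expansion B_model f k' rC.
pose g := partial_sum phi h (maxn N1 N2) f.
have lg : linked_to_zero g.
  apply: (big_ind linked_to_zero linked0 linkedD) => i _.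
  exact/linkedZ/linked_h'.
have d1 : p k (f - g) < r / 2.
  by rewrite seminorm_distC// N1P// leq_maxl.
have d2 : p k (B (f - g)) < r / 2.
  apply: le_lt_trans (BC _) _; rewrite mulrC -ltr_pdivlMr//.
  by rewrite seminorm_distC// N2P// leq_maxr.
have [m0 m0P] := lg k _ r20.
exists m0.+1 => -[//|m] m0m; have [g1 g2] := m0P _ (leqW m0m : (m0 <= m.+1)%N).
have fE : f = (f - g) + g by rewrite subrK.
have -> : r = r / 2 + r / 2 by lra.
rewrite fE; split.
  apply: errorsD => //.
  exact: (errors_single B p_inducing (ltn0Sn m) d1).
rewrite iter_linearD; apply: errorsD => //.
rewrite iterSr; exact: (errors_single B p_inducing (ltnSn m) d2).
Qed.

Theorem divergence_chain_recurrent :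
  (forall n, in_index V n -> model_divergence n) -> CR p B = setT.
Proof.
move=> /linked_all linked; apply/seteqP; split=> // f _.
apply/(chain_recurrentP _ p_inducing) => k r r0.
(* The two error sums only have to add up to [r]; unequal parts leave room for
   the strict inequality in [errorsZ]. *)
have r20 : 0 < r / 4 by rewrite divr_gt0.
have [m0 m0P] := linked f k _ r20.
have [f1 f2] := m0P m0.+1 (leqnSn _).
exists m0.+1; split=> //.
have -> : r = r / 4 + r * (3 / 4) by lra.
apply: errorsD => //; rewrite -scaleN1r; apply: errorsZ f2 => //.
by rewrite modulusN modulus1 mul1r; lra.
Qed.

(** * Chain recurrence implies divergence *)

(** The terms [1 / q m] of a convergent series tend to [0], and [r] is
    arbitrary. *)
Lemma reciprocal_bound_le0 (q : nat -> R) (S t A D : R) :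
  (forall j, 0 < q j) -> (forall m, \sum_(j < m) (q j)^-1 <= S) ->
  0 <= A -> 0 <= D ->
  (forall r M, 0 < r -> exists m, (M <= m)%N /\ t <= A * (q m)^-1 + r * D) ->
  t <= 0.
Proof.
move=> q0 qS A0 D0 tP.
have q_cvg : (q j)^-1 @[j --> \oo] --> 0.
  apply: cvg_series_cvg_0; apply: nondecreasing_is_cvgn.
    apply: (@nondecreasing_series _ (fun j => (q j)^-1) xpredT 0%N) => j _ _.
    by rewrite invr_ge0 ltW.
  by exists S => _ [m _ <-]; rewrite /series/= big_mkord.
apply/ler_addgt0Pr => e e0; rewrite add0r.
have A1 : 0 < A + 1 by lra.
have D1 : 0 < D + 1 by lra.
have e20 : 0 < e / 2 by rewrite divr_gt0.
move/cvgrPdist_lt/(_ _ (divr_gt0 e20 A1)) : q_cvg => [N _ NP].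
have [m [Nm tm]] := tP (e / 2 / (D + 1)) N (divr_gt0 e20 D1).
have := NP m Nm; rewrite /= sub0r normrN ger0_norm ?invr_ge0 ?(ltW (q0 _))// => qm.
apply: le_trans tm _; rewrite [leRHS](splitr e); apply: lerD.
  apply: le_trans (ler_wpM2l A0 (ltW qm)) _.
  by rewrite mulrCA ler_piMr ?(ltW e20)// ler_pdivrMr// mul1r lerDl.
by rewrite mulrAC -mulrA ler_piMr ?(ltW e20)// ler_pdivrMr// mul1r lerDl.
Qed.

(** A closed chain can be repeated, so its length may be assumed large. *)
Lemma late_return f k r M : CR p B f -> 0 < r ->
  exists m, (M <= m)%N /\ errs k r m.+1 (f - iter m.+1 B f).
Proof.
move=> /(chain_recurrentP _ p_inducing) f_cr r0.
have [[|m] [m1 fm]] := f_cr k r r0; first by [].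
have := errors_return p_inducing M.+1 r0 fm.
rewrite (_ : (M.+1 * m.+1)%N = (M.+1 * m.+1).-1.+1)%N; last by lia.
by move=> fM; exists (M.+1 * m.+1).-1; split=> //; lia.
Qed.

(** If the reciprocals were summable, the identity
    [phi n f = phi (n + m + 1) f + sum_(j < m + 1) phi (n + j) (g j)] would force
    [phi n f = 0].  The error [g 0] is estimated by the continuity of [phi n]
    alone, since its bound would involve [h (n - 1)], which is zero when [n] is
    the first positive integer. *)
Lemma chain_recurrent_forward f n k : CR p B f -> in_index V n ->
  phi n f != 0 -> convexly_small (fun j => p k (h (n + j%:Z))).
Proof.
move=> f_cr nV fn.
set q := fun j : nat => p k (h (n + j%:Z)).
have [//|[q0 [S qS]]] := convexly_small_or_summable (fun j => p_ge0 k (h (n + j%:Z))).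
have [k1 [C [C0 bound]]] := shifted_coordinate_bound p_inducing X_frechet B_model k.
have [k2 [D [D0 phiD]]] := phi_dominated B_model n.
have S0 : 0 <= S by have := qS 0%N; rewrite big_ord0.
suff : modulus (phi n f) <= 0 by have := modulus_gt0 fn; lra.
apply: (reciprocal_bound_le0 (A := C * p k1 f) (D := D + C * S) q0 qS).
- by rewrite mulr_ge0// ltW.
- by rewrite addr_ge0 ?mulr_ge0// ltW.
move=> r M r0.
have [m [Mm [g [gr fE]]]] := late_return (maxn k1 k2) M f_cr r0.
exists m; split=> //.
have -> : phi n f = phi (n + m.+1%:Z) f + \sum_(j < m.+1) phi (n + j%:Z) (g j).
  rewrite -[in LHS](subrK (iter m.+1 B f) f) fE linearD linear_sum addrC.
  rewrite phi_iter_shift//; congr (_ + _); apply: eq_bigr => j _.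
  by rewrite phi_iter_shift.
apply: le_trans (modulusD _ _) _; apply: lerD.
  rewrite ler_pdivlMr//; have := bound (n + m.+1%:Z) f.
  by rewrite (_ : n + m.+1%:Z - 1 = n + m%:Z)//; lia.
rewrite big_ord_recl/= addr0; apply: le_trans (modulusD _ _) _.
rewrite mulrDr; apply: lerD.
  rewrite mulrC; apply: le_trans (phiD _) _; rewrite ler_pM2l//.
  apply: le_trans (ltW (gr 0%N isT)).
  by rewrite (inducing_le p_inducing)// leq_maxr.
apply: le_trans (modulus_sum _ _) _.
rewrite mulrA; apply: le_trans (ler_wpM2l _ (qS m)); last first.
  by rewrite mulr_ge0// ltW.
rewrite mulr_sumr; apply: ler_sum => j _; rewrite ler_pdivlMr//.
have := bound (n + j.+1%:Z) (g j.+1).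
rewrite (_ : n + j.+1%:Z - 1 = n + j%:Z); last by lia.
move=> /le_trans; apply; rewrite mulrC ler_pM2r//.
apply: le_trans (ltW (gr j.+1 _)); last exact: ltn_ord.
by rewrite (inducing_le p_inducing)// leq_maxl.
Qed.

(** The same argument for the coordinate [n - m - 1], in which [B^(m + 1) f] has
    the entry [phi n f]. *)
Lemma chain_recurrent_backward f n k : V = Bilateral -> CR p B f ->
  phi n f != 0 -> convexly_small (fun j => p k (h (n - j.+2%:Z))).
Proof.
move=> VB f_cr fn.
have allV m : in_index V m by rewrite VB.
set q := fun j : nat => p k (h (n - j.+2%:Z)).
have [//|[q0 [S qS]]] := convexly_small_or_summable (fun j => p_ge0 k (h (n - j.+2%:Z))).
have [k1 [C [C0 bound]]] := shifted_coordinate_bound p_inducing X_frechet B_model k.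
have S0 : 0 <= S by have := qS 0%N; rewrite big_ord0.
suff : modulus (phi n f) <= 0 by have := modulus_gt0 fn; lra.
apply: (reciprocal_bound_le0 (A := C * p k1 f) (D := C * S) q0 qS).
- by rewrite mulr_ge0// ltW.
- by rewrite mulr_ge0// ltW.
move=> r M r0.
have [m [Mm [g [gr fE]]]] := late_return k1 M f_cr r0.
exists m; split=> //.
have -> : phi n f = phi (n - m.+1%:Z) f -
    \sum_(i < m.+1) phi (n - i.+1%:Z) (g (m - i)%N).
  have -> : \sum_(i < m.+1) phi (n - i.+1%:Z) (g (m - i)%N) =
      phi (n - m.+1%:Z) (f - iter m.+1 B f).
    rewrite fE linear_sum (reindex_inj rev_ord_inj)/=; apply: eq_bigr => i _.
    rewrite phi_iter_shift// subSS subKn ?leq_ord//.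
    by congr (phi _ _); have := ltn_ord i; lia.
  by rewrite linearB/= -iterS phi_iter_shift// subrK opprB addrC subrK.
apply: le_trans (modulusD _ _) _; rewrite modulusN; apply: lerD.
  rewrite ler_pdivlMr//; have := bound (n - m.+1%:Z) f.
  by rewrite (_ : n - m.+1%:Z - 1 = n - m.+2%:Z)//; lia.
apply: le_trans (modulus_sum _ _) _.
rewrite mulrA; apply: le_trans (ler_wpM2l _ (qS m.+1)); last first.
  by rewrite mulr_ge0// ltW.
rewrite mulr_sumr; apply: ler_sum => i _; rewrite ler_pdivlMr//.
have := bound (n - i.+1%:Z) (g (m - i)%N).
rewrite (_ : n - i.+1%:Z - 1 = n - i.+2%:Z); last by lia.
move=> /le_trans; apply; rewrite mulrC ler_pM2r// ltW// gr//; lia.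
Qed.

Theorem chain_recurrent_divergence f : f != 0 -> CR p B f ->
  exists2 n, in_index V (n + 1) & model_divergence n.
Proof.
move=> f0 f_cr.
have [n fn] : exists n, phi n f != 0.
  apply: contrapT => nex; move: f0; rewrite (phi_total B_model (f := f)) ?eqxx// => n.
  by apply/eqP/negPn/negP => fn; apply: nex; exists n.
have nV : in_index V n.
  by apply: contraNT fn => nV; rewrite (phi_out B_model).
exists (n - 1) => [|k]; first by rewrite subrK.
split=> [|VB].
  apply: convexly_small_le (chain_recurrent_forward k f_cr nV fn) => j.
  by rewrite (_ : n - 1 + j.+1%:Z = n + j%:Z)//; lia.
apply: convexly_small_le (chain_recurrent_backward k VB f_cr fn) => j.
by rewrite (_ : n - 1 - j.+1%:Z = n - j.+2%:Z)//; lia.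
Qed.

End Equivalence.

(** * Removing the weights *)

Section AtInt.
Context {V : index_kind}.

Lemma at_int_val (T : nmodType) (u : index_set V -> T) (v : index_set V) :
  at_int u (val v) = u v.
Proof. by rewrite /at_int valK. Qed.

Lemma at_int_out (T : nmodType) (u : index_set V -> T) n :
  ~~ in_index V n -> at_int u n = 0.
Proof. by move=> nV; rewrite /at_int insubN. Qed.

Lemma in_indexP n : in_index V n -> exists v : index_set V, n = val v.
Proof. by move=> nV; exists (exist _ n nV). Qed.

End AtInt.

Section Realization.
Context {R : realType} {s : scalar_kind} {V : index_kind}.
Local Notation K := (scalar_field R s).
Context {X : tvsType K}.
Variables (emb : {linear X -> (index_set V -> K^o)}).
Variables (e : index_set V -> X) (p : nat -> X -> R).
Variables (lambda : index_set V -> K) (B : X -> X).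
Hypothesis X_seq : frechet_sequence_space emb.
Hypothesis e_unit : forall n, emb (e n) = unit_sequence n.
Hypothesis e_basis : schauder_basis e.
Hypothesis p_inducing : increasing_seminorms_inducing p.
Hypothesis lambda_neq0 : forall n, lambda n != 0.
Hypothesis B_shift : forall f, emb (B f) = weighted_shift lambda (emb f).

Let p_seminorm k : seminorm (p k). Proof. by case: p_inducing. Qed.
Let emb_inj : injective emb. Proof. by case: X_seq. Qed.

Definition coordinate (n : int) (f : X) : K := at_int (emb f) n.

Lemma coordinateP n a f g :
  coordinate n (a *: f + g) = a * coordinate n f + coordinate n g.
Proof.
rewrite /coordinate; have [/in_indexP[v ->]|nV] := boolP (in_index V n).
  by rewrite !at_int_val linearP.
by rewrite !at_int_out// mulr0 addr0.
Qed.

Lemma coordinate_shift n f : in_index V n ->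
  coordinate n (B f) = at_int lambda (n + 1) * coordinate (n + 1) f.
Proof. by move=> /in_indexP[v ->]; rewrite /coordinate at_int_val B_shift. Qed.

Lemma coordinate_total f : (forall n, coordinate n f = 0) -> f = 0.
Proof.
move=> f0; apply: emb_inj; rewrite linear0; apply/funext => v.
by rewrite -[LHS]at_int_val; exact: f0.
Qed.

Lemma coordinate_unit n m : in_index V n -> coordinate n (at_int e m) = (n == m)%:R.
Proof.
move=> nV; have [/in_indexP[v ->]|mV] := boolP (in_index V m).
  rewrite at_int_val /coordinate e_unit; have [w ->] := in_indexP nV.
  by rewrite at_int_val /unit_sequence val_eqE.
rewrite (at_int_out _ mV) (_ : (n == m) = false); last first.
  by apply: contraNF mV => /eqP <-.
have := coordinateP n 0 0 0; rewrite scale0r addr0 mul0r add0r => ->.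
have [w ->] := in_indexP nV.
by rewrite /coordinate at_int_val linear0.
Qed.

(** Continuity of the embedding into the product space, at the origin. *)
Lemma coordinate_dominated n : dominated p (fun f => modulus (coordinate n f)).
Proof.
have [/in_indexP[v ->]|nV] := boolP (in_index V n); last first.
  apply: dominated_le (dominated0 p_inducing) => f.
  by rewrite /coordinate at_int_out// modulus0.
have emb_cont : continuous (fun f => emb f v : K^o).
  move=> f; apply: (@continuous_comp _ _ _
    (emb : X -> {ptws index_set V -> K^o}) (fun u => u v)).
    by case: X_seq => _ _; exact.
  exact: (@proj_continuous (index_set V) (fun=> K^o) v).
have : nbhs (0 : X) [set f | modulus (coordinate (val v) f) < 1].
  have := emb_cont 0; rewrite /continuous_at linear0 => /cvgrPdist_lt/(_ 1 ltr01).
  apply: filterS => f /=; rewrite /coordinate at_int_val sub0r normrN norm_modulus.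
  by rewrite -real_scalar1 ltr_real_scalar.
move=> /(nbhs_inducing p_inducing) [k [r r0 kr]].
exists k, (1 / r); split=> [|f]; first exact: divr_gt0.
apply: (dominated_bounded_ball p_inducing (q := fun f => modulus (coordinate (val v) f))).
- split=> [g g'|a g].
    have := coordinateP (val v) 1 g g'; rewrite scale1r mul1r => ->.
    exact: modulusD.
  have := coordinateP (val v) a g 0; rewrite addr0 => ->.
  by rewrite {2}/coordinate at_int_val linear0 addr0 modulusM.
- exact: r0.
- exact: ler01.
- by move=> g gr; apply/ltW/kr; rewrite /= subr0.
Qed.

Lemma coordinate_sum n (a : int -> K) N : in_index V n -> (`|n| <= N)%N ->
  coordinate n (\sum_(i < N.*2.+1) a (i%:Z - N%:Z) *: at_int e (i%:Z - N%:Z)) = a n.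
Proof.
move=> nV nN.
have coord0 : coordinate n 0 = 0.
  by have [w ->] := in_indexP nV; rewrite /coordinate at_int_val linear0.
rewrite (big_morph (coordinate n) (id1 := 0) (op1 := +%R)); last exact: coord0.
  have iN : (`|(n + N%:Z)%R|%N < N.*2.+1)%N by lia.
  rewrite (bigD1 (Ordinal iN))//= big1 ?addr0.
    have -> : `|(n + N%:Z)%R|%N%:Z - N%:Z = n by lia.
    have := coordinateP n (a n) (at_int e n) 0; rewrite addr0 => ->.
    by rewrite coord0 addr0 coordinate_unit// eqxx mulr1.
  move=> i iNi; have := coordinateP n (a (i%:Z - N%:Z)) (at_int e (i%:Z - N%:Z)) 0.
  rewrite addr0 => ->; rewrite coord0 addr0 coordinate_unit//.
  rewrite (_ : (n == _) = false) ?mulr0//.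
  by apply: contraNF iNi => /eqP E; apply/eqP/val_inj => /=; lia.
by move=> f g; have := coordinateP n 1 f g; rewrite scale1r mul1r.
Qed.

(** The coefficients of the basis expansion are the coordinates, because the
    coordinates are continuous and those of the partial sums are eventually
    constant. *)
Lemma coordinate_expansion f k (eps : R) : 0 < eps ->
  exists N0, forall N, (N0 <= N)%N ->
    p k (\sum_(i < N.*2.+1)
           coordinate (i%:Z - N%:Z) f *: at_int e (i%:Z - N%:Z) - f) < eps.
Proof.
move=> eps0; have [a [a_cvg _]] := e_basis f.
have a_close k' (r : R) : 0 < r -> exists N0, forall N, (N0 <= N)%N ->
    p k' (\sum_(i < N.*2.+1)
           at_int a (i%:Z - N%:Z) *: at_int e (i%:Z - N%:Z) - f) < r.
  move=> r0; have : nbhs f [set g | p k' (g - f) < r].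
    by apply/(nbhs_inducing p_inducing); exists k', r.
  by move=> /a_cvg [N0 _ N0P]; exists N0 => N /N0P.
suff aE n : at_int a n = coordinate n f.
  have [N0 N0P] := a_close k _ eps0; exists N0 => N /N0P.
  by under eq_bigr do rewrite aE.
have [nV|nV] := boolP (in_index V n); last by rewrite /coordinate !at_int_out.
have [k' [C [C0 coordC]]] := coordinate_dominated n.
apply/eqP; rewrite -subr_eq0; apply/eqP/modulus_eq0/le_anti.
rewrite modulus_ge0 andbT; apply/ler_addgt0Pr => t t0; rewrite add0r.
have [N0 N0P] := a_close k' _ (divr_gt0 t0 C0).
have := N0P (maxn N0 `|n|%N) (leq_maxl _ _).
set S := \sum_(i < _) _ => S_close.
have -> : at_int a n - coordinate n f = coordinate n (S - f).
  have := coordinateP n (-1) f S; rewrite scaleN1r mulN1r [S - f]addrC => ->.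
  by rewrite /S coordinate_sum ?leq_maxr// addrC.
apply: le_trans (coordC _) _; rewrite mulrC -ler_pdivlMr//; exact: ltW.
Qed.

(** The solution of [W (n + 1) = W n * lambda (n + 1)] with [W 0 = 1].  On the
    positive integers it is only meaningful for [n >= 0], since [lambda] is
    extended by zero. *)
Definition weight (n : int) : K :=
  match n with
  | Posz m => \prod_(i < m) at_int lambda i.+1%:Z
  | Negz m => (\prod_(i < m.+1) at_int lambda (- i%:Z))^-1
  end.

Lemma at_lambda_neq0 n : in_index V n -> at_int lambda n != 0.
Proof. by move=> /in_indexP[v ->]; rewrite at_int_val. Qed.

Lemma weightS n : (n == 0) || in_index V n ->
  weight (n + 1) = weight n * at_int lambda (n + 1).
Proof.
case: n => [m|[|m]] nV.
- by rewrite (_ : m%:Z + 1 = m.+1%:Z)/=; [rewrite big_ord_recr | lia].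
- rewrite (_ : Negz 0 + 1 = 0)//= big_ord0 big_ord1 mulVf//.
  by apply: at_lambda_neq0; case: V nV.
- rewrite (_ : Negz m.+1 + 1 = Negz m); last by lia.
  have l0 : at_int lambda (- m.+1%:Z) != 0.
    by apply: at_lambda_neq0; case: V nV.
  by rewrite [in RHS]/= big_ord_recr/= invfM NegzE -mulrA mulVf ?mulr1.
Qed.

Lemma weight_neq0 n : (n == 0) || in_index V n -> weight n != 0.
Proof.
case: n => m nV /=.
  apply/prodf_neq0 => i _; apply: at_lambda_neq0; case: V nV => //=; lia.
rewrite invr_eq0; apply/prodf_neq0 => i _; apply: at_lambda_neq0.
by case: V nV.
Qed.

Lemma index_orP n : in_index V n -> (n == 0) || in_index V n.
Proof. by move=> ->; rewrite orbT. Qed.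

Definition scaled_coordinate (n : int) (f : X) : K := weight n * coordinate n f.
Definition scaled_unit (n : int) : X := (weight n)^-1 *: at_int e n.

Fact scaled_coordinate_linear n : linear_for *%R (scaled_coordinate n).
Proof.
by move=> a f g; rewrite /scaled_coordinate coordinateP mulrDr mulrCA.
Qed.

HB.instance Definition _ n := GRing.isLinear.Build K X K *%R (scaled_coordinate n)
  (scaled_coordinate_linear n).

Fact shift_linear : linear B.
Proof.
move=> a f g; apply: emb_inj; rewrite linearP/= !B_shift.
apply/funext => v; have vV : in_index V (val v + 1).
  by case: v => n; case: V => //=; lia.
have := coordinateP (val v + 1) a f g; rewrite /coordinate => coordE.
by rewrite /weighted_shift coordE mulrDr mulrCA.
Qed.

HB.instance Definition _ := GRing.isLinear.Build K X X *:%R B shift_linear.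

Lemma shift_realization : shift_model V p scaled_coordinate scaled_unit B.
Proof.
have scaled_out n f : ~~ in_index V n -> scaled_coordinate n f = 0.
  by move=> nV; rewrite /scaled_coordinate /coordinate at_int_out// mulr0.
have unit_out n : ~~ in_index V n -> scaled_unit n = 0.
  by move=> nV; rewrite /scaled_unit at_int_out// scaler0.
have scaled_h n m : in_index V n -> scaled_coordinate n (scaled_unit m) = (n == m)%:R.
  move=> nV; have := coordinateP n (weight m)^-1 (at_int e m) 0.
  rewrite addr0 /scaled_coordinate => ->; rewrite coordinate_unit//.
  have -> : coordinate n 0 = 0.
    by have [w ->] := in_indexP nV; rewrite /coordinate at_int_val linear0.
  rewrite addr0; have [<-|_] := eqVneq n m; last by rewrite !mulr0.
  by rewrite mulr1 divff// weight_neq0// index_orP.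
have scaled_shift n f : in_index V n ->
    scaled_coordinate n (B f) = scaled_coordinate (n + 1) f.
  move=> nV; rewrite /scaled_coordinate coordinate_shift// weightS ?index_orP//.
  by rewrite mulrA.
have scaled_total f : (forall n, scaled_coordinate n f = 0) -> f = 0.
  move=> f0; apply: coordinate_total => n.
  have [nV|nV] := boolP (in_index V n); last by rewrite /coordinate at_int_out.
  by have /eqP := f0 n; rewrite mulf_eq0 (negPf (weight_neq0 (index_orP nV))) => /eqP.
split => //.
- move=> n; apply/eqP; rewrite -subr_eq0; apply/eqP/scaled_total => m.
  have [mV|mV] := boolP (in_index V m); last exact: scaled_out.
  rewrite linearB/= scaled_shift// !scaled_h ?(in_indexD 1 mV)//.
  by rewrite -subr_eq opprK subrr.
- move=> n.
  apply: dominated_le (dominatedZ p_inducing (modulus_ge0 (weight n))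
    (coordinate_dominated n)) => f.
  by rewrite modulusM.
- move=> f k eps eps0; have [N0 N0P] := coordinate_expansion f k eps0.
  exists N0 => N /N0P; rewrite /partial_sum.
  under eq_bigr => i _.
    rewrite (_ : _ *: _ = scaled_coordinate (i%:Z - N%:Z) f *: scaled_unit (i%:Z - N%:Z)).
      over.
    have [nV|nV] := boolP (in_index V (i%:Z - N%:Z)).
      rewrite /scaled_coordinate /scaled_unit scalerA mulrAC divff ?mul1r//.
      exact/weight_neq0/index_orP.
    by rewrite scaled_out// scale0r /coordinate at_int_out// scale0r.
  by [].
Qed.

Lemma weight_prod_forward n0 n : (n0 == 0) || in_index V n0 ->
  weight (n0 + n%:Z) = weight n0 * \prod_(1 <= i < n.+1) at_int lambda (n0 + i%:Z).
Proof.
move=> n0V; elim: n => [|n IH]; first by rewrite addr0 big_geq// mulr1.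
rewrite big_nat_recr//= mulrA -IH (_ : n0 + n.+1%:Z = n0 + n%:Z + 1); last by lia.
by rewrite weightS//; move: n0V; case: V => //=; lia.
Qed.

Lemma weight_prod_backward n0 n : V = Bilateral ->
  weight n0 = weight (n0 - n%:Z) * \prod_(0 <= i < n) at_int lambda (n0 - i%:Z).
Proof.
move=> VB; elim: n => [|n IH]; first by rewrite subr0 big_geq// mulr1.
rewrite big_nat_recr//= [in LHS]IH (_ : n0 - n%:Z = n0 - n.+1%:Z + 1); last by lia.
rewrite weightS; last by rewrite VB orbT.
by rewrite -mulrA [X in _ * X]mulrC.
Qed.

(** Since [lambda (n0 + 1) * .. * lambda (n0 + n) = W (n0 + n) / W n0] and
    [p k (h i) = p k (e i) / |W i|], the terms of both series are the inverses
    of [|W n0| * p k (h i)]. *)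
Lemma divergence_conditionP n0 : (n0 == 0) || in_index V n0 ->
  divergence_condition p e lambda n0 <->
  model_divergence (V := V) (p := p) (h := scaled_unit) n0.
Proof.
move=> n0V.
have w0 : 0 < modulus (weight n0) by rewrite modulus_gt0// weight_neq0.
have p_ge0 k f : 0 <= p k f by exact: seminorm_ge0.
have rescale (q : nat -> R) :
    convexly_small (fun j => modulus (weight n0) * q j) <-> convexly_small q.
  split=> [|qs]; last exact: convexly_smallZ.
  move=> /(convexly_smallZ (c := (modulus (weight n0))^-1)).
  rewrite invr_gt0 => /(_ w0); apply: convexly_small_le => j.
  by rewrite mulKf// gt_eqF.
have p_unit k n : p k (scaled_unit n) = (modulus (weight n))^-1 * p k (at_int e n).
  by rewrite /scaled_unit seminormZ// modulusV.
have inv_term (a b : R) : 0 < a -> (a%:E / b%:E = ((a^-1 * b)%:E)^-1 :> \bar R)%E.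
  move=> a0; rewrite !inver mulf_eq0 invr_eq0 (gt_eqF a0)/=.
  by case: eqP => [_|_]; [rewrite gt0_muley ?lte_fin | rewrite invfM invrK EFinM].
have fwd k : forward_series p e lambda n0 k = +oo%E <->
    convexly_small (fun j => p k (scaled_unit (n0 + j.+1%:Z))).
  rewrite -rescale -reciprocal_series_pinfty; last by move=> j; rewrite mulr_ge0// ltW.
  rewrite (_ : forward_series p e lambda n0 k = (\sum_(1 <= n <oo)
    ((modulus (weight n0) * p k (scaled_unit (n0 + n.-1.+1%:Z)))%:E)^-1)%E)//.
  congr (limn _); apply/funext => N; apply: eq_big_nat => -[//|n] _.
  rewrite inv_term; last first.
    rewrite modulus_gt0//.
    have := @weight_neq0 (n0 + n.+1%:Z); rewrite weight_prod_forward//.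
    rewrite mulf_eq0 negb_or => wP; apply: (andP (wP _)).2.
    by move: n0V; case: V => //=; lia.
  rewrite p_unit weight_prod_forward// modulusM invfM /=.
  by rewrite !mulrA divff ?mul1r// gt_eqF.
have bwd k : V = Bilateral -> backward_series p e lambda n0 k = +oo%E <->
    convexly_small (fun j => p k (scaled_unit (n0 - j.+1%:Z))).
  move=> VB.
  rewrite -rescale -reciprocal_series_pinfty; last by move=> j; rewrite mulr_ge0// ltW.
  rewrite (_ : backward_series p e lambda n0 k = (\sum_(1 <= n <oo)
    ((modulus (weight n0) * p k (scaled_unit (n0 - n.-1.+1%:Z)))%:E)^-1)%E)//.
  congr (limn _); apply/funext => N; apply: eq_big_nat => -[//|n] _.
  rewrite mul1e p_unit (weight_prod_backward n0 n.+1 VB) modulusM /=.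
  rewrite !mulrA (mulrAC (modulus (weight _))) divff; last first.
    by rewrite gt_eqF// modulus_gt0// weight_neq0// VB orbT.
  by rewrite mul1r.
by split=> n0_div k; have [/fwd f1 f2] := n0_div k; split=> // VB; apply/bwd => //;
  exact: f2.
Qed.

Lemma unit_neq0 : exists f : X, f != 0.
Proof.
have V1 : in_index V 1 by case: V.
exists (at_int e 1); apply/eqP => e0.
have := coordinate_unit 1 V1; rewrite e0 eqxx.
have [w ->] := in_indexP V1.
by rewrite /coordinate at_int_val linear0 => /eqP; rewrite eq_sym oner_eq0.
Qed.

End Realization.

Theorem theorem5p1 (R : realType) (s : scalar_kind) (V : index_kind)
    (X : tvsType (scalar_field R s))
    (emb : {linear X -> (index_set V -> (scalar_field R s)^o)})
    (e : index_set V -> X) (p : nat -> X -> R)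
    (lambda : index_set V -> scalar_field R s) (B : X -> X)
    (X_seq : frechet_sequence_space emb)
    (e_unit : forall n, emb (e n) = unit_sequence n)
    (e_basis : schauder_basis e)
    (p_seminorms : increasing_seminorms_inducing p)
    (lambda_neq0 : forall n, lambda n != 0)
    (B_shift : forall f, emb (B f) = weighted_shift lambda (emb f)) :
  [/\ chain_recurrent_operator p B <->
        (exists2 f : X, f != 0 & CR p B f),
      (exists2 f : X, f != 0 & CR p B f) <->
        (exists2 n0 : int, (n0 == 0) || in_index V n0 &
           divergence_condition p e lambda n0)
    & (exists2 n0 : int, (n0 == 0) || in_index V n0 &
         divergence_condition p e lambda n0) <->
      (forall n0 : int, (n0 == 0) || in_index V n0 ->
         divergence_condition p e lambda n0)].
Proof.
have X_frechet : frechet X by case: X_seq.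
have B_model := shift_realization X_seq e_unit e_basis p_seminorms lambda_neq0 B_shift.
have divP n0 n0V := divergence_conditionP e p_seminorms lambda_neq0 (n0 := n0) n0V.
pose some_vector := exists2 f : X, f != 0 & CR p B f.
pose some_index := exists2 n0 : int, (n0 == 0) || in_index V n0 &
  divergence_condition p e lambda n0.
pose all_indices := forall n0 : int, (n0 == 0) || in_index V n0 ->
  divergence_condition p e lambda n0.
have operator_vector : chain_recurrent_operator p B -> some_vector.
  move=> B_cr; have [f f0] := unit_neq0 e_unit; exists f => //.
  by rewrite B_cr.
have vector_index : some_vector -> some_index.
  move=> [f f0 f_cr].
  have [n nV n_div] := chain_recurrent_divergence p_seminorms X_frechet B_model f0 f_cr.
  have nV' : (n == 0) || in_index V n.
    by move: nV; case: (V) => //=; lia.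
  by exists n => //; apply/divP.
have index_all : some_index -> all_indices.
  move=> [n nV /(divP _ nV) n_div] n' n'V; apply/divP => //.
  exact: (model_divergence_indep p_seminorms B_model nV n'V n_div).
have all_operator : all_indices -> chain_recurrent_operator p B.
  move=> all_div.
  apply: (divergence_chain_recurrent p_seminorms X_frechet B_model) => n nV.
  have nV' := index_orP nV; exact/divP/all_div.
have all_index : all_indices -> some_index by move=> all_div; exists 0 => //; exact: all_div.
split; split=> [H|H].
- exact: operator_vector.
- exact/all_operator/index_all/vector_index.
- exact: vector_index.
- exact/operator_vector/all_operator/index_all.
- exact: index_all.
- exact: all_index.
Qed.
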